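(* Let $\mu$ be a Radon measure on $\mathbb{R}^2$. If $\mu$ is singular with respect to Lebesgue measure $m_2$, then the module $\Upsilon(\mathbb{R}^2,\mu)$ has rank at most $1$.
   Context: For a metric space $X$ with Borel measure $\mu$, $\mathrm{Lip}_b(X)$ is the space of bounded Lipschitz functions with norm $\max(\sup|f|,L(f))$. A derivation is a linear map $\delta:\mathrm{Lip}_b(X)\to L^\infty(X,\mu)$ satisfying the Leibniz rule $\delta(fg)=f\delta g+g\delta f$ and such that whenever a net $(f_\alpha)$ with $\sup_\alpha\|f_\alpha\|_{\mathrm{Lip}}<\infty$ converges pointwise to $f$, $\delta f_\alpha\to\delta f$ weak-* in $L^\infty(X,\mu)$. $\Upsilon(X,\mu)$, the set of derivations, is an $L^\infty(X,\mu)$-module via $(\lambda\delta)f=\lambda\,\delta f$. A set $\{\delta_i\}_{i=1}^N$ is linearly independent if $\sum_i\lambda_i\delta_i=0$ with $\lambda_i\in L^\infty(X,\mu)$ implies all $\lambda_i=0$; the rank is the largest cardinality of a linearly independent set. *)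

(* Defs.v *)
From HB Require Import structures.
From mathcomp Require Import all_boot all_order all_algebra.
From mathcomp Require Import all_classical all_reals all_analysis.
Set Implicit Arguments. Unset Strict Implicit. Unset Printing Implicit Defensive.
Import Order.TTheory GRing.Theory Num.Theory.
Local Open Scope classical_set_scope.
Local Open Scope ring_scope.

(* The plane R^2, with its Borel sigma-algebra (= product of Borel sigma-algebras). *)
Definition plane (R : realType) := (measurableTypeR R * measurableTypeR R)%type.

Definition edist (R : realType) (p q : plane R) : R :=
  Num.sqrt ((p.1 - q.1 : R) ^+ 2 + (p.2 - q.2 : R) ^+ 2).

Definition eball (R : realType) (x : plane R) (r : R) : set (plane R) :=
  [set y | edist x y < r].

(* Radon measure on R^2: a locally finite Borel measure (on R^2 inner/outer
   regularity are automatic for such measures). *)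
Definition locally_finite (R : realType)
  (mu : {measure set (plane R) -> \bar R}) : Prop :=
  forall x : plane R, exists2 r : R, 0 < r & (mu (eball x r) < +oo)%E.

Definition leb2 (R : realType) : set (plane R) -> \bar R :=
  (@lebesgue_measure R \x @lebesgue_measure R)%E.

Definition singular_wrt_leb2 (R : realType)
  (mu : {measure set (plane R) -> \bar R}) : Prop :=
  exists N : set (plane R), [/\ measurable N, mu (~` N) = 0%E & @leb2 R N = 0%E].

Definition lip_le (R : realType) (C : R) (f : plane R -> R) : Prop :=
  (forall x, `|f x| <= C) /\ (forall x y, `|f x - f y| <= C * edist x y).

Definition Lipb (R : realType) (f : plane R -> R) : Prop :=
  exists C : R, lip_le C f.

Definition directed_set (I : Type) (le : I -> I -> Prop) : Prop :=
  [/\ exists i : I, True,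
      (forall i, le i i),
      (forall i j k, le i j -> le j k -> le i k) &
      (forall i j, exists k, le i k /\ le j k)].

Definition net_cvg (R : realType) (I : Type) (le : I -> I -> Prop)
  (x : I -> R) (l : R) : Prop :=
  forall e : R, 0 < e -> exists i0, forall i, le i0 i -> `|x i - l| < e.

(* Elements of L^infty(X, mu) are represented by measurable essentially bounded
   functions; equality in L^infty is mu-a.e. equality. *)
Definition Linfty (R : realType) (mu : {measure set (plane R) -> \bar R})
  (g : plane R -> R) : Prop :=
  measurable_fun setT g /\ exists C : R, {ae mu, forall x, `|g x| <= C}.

(* Derivations: delta maps Lip_b into L^infty (values of delta outside Lip_b
   are irrelevant), is linear, satisfies the Leibniz rule, and is weak-*
   continuous along bounded pointwise convergent nets. *)
Definition derivation (R : realType) (mu : {measure set (plane R) -> \bar R})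
  (delta : (plane R -> R) -> (plane R -> R)) : Prop :=
  [/\ (forall f, Lipb f -> Linfty mu (delta f)),
      (forall (a b : R) f g, Lipb f -> Lipb g ->
         {ae mu, forall x, delta (fun y => a * f y + b * g y) x
                           = a * delta f x + b * delta g x}),
      (forall f g, Lipb f -> Lipb g ->
         {ae mu, forall x, delta (fun y => f y * g y) x
                           = f x * delta g x + g x * delta f x}) &
      (forall (I : Type) (le : I -> I -> Prop) (fa : I -> plane R -> R)
              (f : plane R -> R) (C : R),
         directed_set le ->
         (forall i, lip_le C (fa i)) ->
         Lipb f ->
         (forall x, net_cvg le (fun i => fa i x) (f x)) ->
         forall g : plane R -> R, mu.-integrable setT (fun x => (g x)%:E) ->
           net_cvg le (fun i => Rintegral mu setT (fun x => g x * delta (fa i) x))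
                      (Rintegral mu setT (fun x => g x * delta f x)))].

Definition deriv_eq (R : realType) (mu : {measure set (plane R) -> \bar R})
  (d1 d2 : (plane R -> R) -> (plane R -> R)) : Prop :=
  forall f, Lipb f -> {ae mu, forall x, d1 f x = d2 f x}.

Definition lin_indep (R : realType) (mu : {measure set (plane R) -> \bar R})
  (N : nat) (delta : 'I_N -> (plane R -> R) -> (plane R -> R)) : Prop :=
  forall lam : 'I_N -> plane R -> R,
    (forall i, Linfty mu (lam i)) ->
    (forall f, Lipb f ->
       {ae mu, forall x, \sum_(i < N) lam i x * delta i f x = 0}) ->
    forall i, {ae mu, forall x, lam i x = 0}.

(* rank Upsilon(X, mu) <= k: every linearly independent set of derivations
   (a family of pairwise distinct elements of Upsilon) has cardinality <= k. *)
Definition rank_le (R : realType) (mu : {measure set (plane R) -> \bar R})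
  (k : nat) : Prop :=
  forall (N : nat) (delta : 'I_N -> (plane R -> R) -> (plane R -> R)),
    (forall i, derivation mu (delta i)) ->
    (forall i j, i != j -> ~ deriv_eq mu (delta i) (delta j)) ->
    lin_indep mu delta ->
    (N <= k)%N.

(* Main.v *)
(** A derivation [D] is local: [D f = D g] almost everywhere on [{f = g}]; and
    it is determined by its values on the two coordinates.  Hence, if two
    derivations [d1], [d2] are independent, their Wronskian
    [w = d1 x * d2 y - d2 x * d1 y] cannot vanish almost everywhere, and it
    suffices to show that singularity of [mu] forces [w = 0].

    Since [mu] lives on a Lebesgue null set, for every [t > 0] all but [t] of the
    [mu]-mass of a square is covered by [n] grid cells of side [h] with
    [n h^2 <= t^2].  A Dilworth-type argument splits the cells into a part whose
    steep chains ([|dx| < dy]) and a part whose flat chains ([|dy| < dx]) have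
    length about [sqrt n].  The first part is covered by about [sqrt n] strips of
    width [h] around 1-Lipschitz graphs over the x-axis.  There is a function
    [0 <= f <= C t], Lipschitz with a constant independent of [t], nondecreasing
    in [y] and with slope one in [y] along the strips.  Letting [t] tend to [0],
    weak-* continuity of the combination of [d1], [d2] that kills [x] and maps
    [y] to [w^2] shows that the first part carries a vanishing amount of the mass
    of [w^2 mu]; exchanging the coordinates, so does the second. *)

Require Import Defs.
From mathcomp Require Import all_boot all_order all_algebra.
From mathcomp Require Import all_classical all_reals all_analysis.
From mathcomp Require Import measurable_realfun zify ring lra.
Set Implicit Arguments. Unset Strict Implicit. Unset Printing Implicit Defensive.
Import Order.TTheory GRing.Theory Num.Theory.
Import numFieldNormedType.Exports.

Local Open Scope classical_set_scope.
Local Open Scope ring_scope.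

(** * Chains of points *)

Definition chain_bound (T : eqType) (r : rel T) (n : nat) (s : seq T) : Prop :=
  forall c, sorted r c -> {subset c <= s} -> (size c <= n)%N.

Lemma sorted_pair (T : eqType) (r : rel T) (c : seq T) (x y : T) :
  transitive r -> sorted r c -> x \in c -> y \in c -> [|| x == y, r x y | r y x].
Proof.
move=> rT; elim: c => // a c IH /= ac; rewrite !in_cons.
have ac' := order_path_min rT ac.
move=> /orP[/eqP->|xc] /orP[/eqP->|yc]; rewrite ?eqxx //.
- by rewrite (allP ac') // orbT.
- by rewrite (allP ac') // !orbT.
- exact: IH (path_sorted ac) xc yc.
Qed.

(* Greedy decomposition: keep removing an [r1]-chain of length [> b]; each
   removed chain is an antichain for [r2], so it raises the [r2]-height by at
   most one. *)
Lemma chain_split (T : eqType) (r1 r2 : rel T) (a b : nat) (P : seq T) :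
  transitive r1 -> transitive r2 -> irreflexive r1 -> irreflexive r2 ->
  (forall x y, r1 x y -> ~~ r2 x y /\ ~~ r2 y x) ->
  (size P <= a * b)%N ->
  exists P1 P2, [/\ P =i P1 ++ P2, chain_bound r1 b P1 & chain_bound r2 a P2].
Proof.
move=> r1T r2T r1I r2I r12; elim: a P => [|a IH] P.
  rewrite mul0n leqn0 size_eq0 => /eqP ->; exists [::], [::].
  by split=> // -[|x c] _ // /(_ x); rewrite mem_head => /(_ isT).
move=> sP; have [bP|] := pselect (chain_bound r1 b P).
  exists P, [::]; split => //; first by move=> x; rewrite cats0.
  by move=> [|x c] _ // /(_ x); rewrite mem_head => /(_ isT).
move=> /existsNP[C /not_implyP[sC /not_implyP[CP /negP]]]; rewrite -ltnNge => bC.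
have uC : uniq C by exact: sorted_uniq sC.
(* [C] has no repetitions and more than [b] members, so at most [a * b] entries of [P] lie outside
   it. *)
have [|P1 [P2 [PP bP1 bP2]]] := IH [seq x <- P | x \notin C].
  rewrite -(leq_add2l (size [seq x <- P | x \in C])) !size_filter count_predC.
  apply: leq_trans sP _; rewrite mulSn leq_add2r -size_filter.
  apply: leq_trans (ltnW bC) _; apply: uniq_leq_size => // x xC.
  by rewrite mem_filter xC CP.
exists P1, (C ++ P2); split => //.
  move=> x; rewrite !mem_cat; have := PP x; rewrite mem_filter mem_cat.
  have [xC /=|xC /= ->] := boolP (x \in C); last by [].
  by rewrite CP // orbT.
move=> c sc cCP.
have rem : (size [seq x <- c | x \notin C] <= a)%N.
  apply: bP2; first exact: sorted_filter.
  move=> x; rewrite mem_filter => /andP[xC /cCP]; rewrite mem_cat (negPf xC).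
  by [].
rewrite -(count_predC (mem C) c) -addn1 addnC leq_add // -?size_filter //.
have : sorted r2 [seq x <- c | x \in C] by exact: sorted_filter.
have : {subset [seq x <- c | x \in C] <= C}.
  by move=> x; rewrite mem_filter => /andP[].
case: [seq x <- c | x \in C] => [|x [|y s]] //= sub /andP[rxy _].
have xC : x \in C by apply: sub; rewrite mem_head.
have yC : y \in C by apply: sub; rewrite !in_cons eqxx orbT.
have /or3P[/eqP xy|/r12[]|/r12[]] := sorted_pair r1T sC xC yC.
- by move: rxy; rewrite xy r2I.
- by rewrite rxy.
- by rewrite rxy.
Qed.

(* Iterating [upper] filters the points by height. *)
Definition upper (T : eqType) (r : rel T) (s : seq T) : seq T :=
  [seq q <- s | has (fun p => r p q) s].

Lemma iter_upper_sub (T : eqType) (r : rel T) (s : seq T) (i j : nat) :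
  (i <= j)%N -> {subset iter j (upper r) s <= iter i (upper r) s}.
Proof.
move=> /subnK <-; elim: (j - i)%N => // n IH x; rewrite addSn /=.
by rewrite mem_filter => /andP[_ /IH].
Qed.

(** Surviving a round means having an [r]-predecessor that survived all earlier rounds; following
    predecessors back gives the chain. *)
Lemma iter_upper_chain (T : eqType) (r : rel T) (s : seq T) (n : nat) (q : T) :
  q \in iter n (upper r) s ->
  exists c, [/\ sorted r (rcons c q), size c = n & {subset rcons c q <= s}].
Proof.
elim: n q => [|n IH] q /=.
  by move=> qs; exists [::]; split => // x; rewrite inE => /eqP ->.
rewrite mem_filter => /andP[/hasP[p /IH[c [sc nc cs]] rpq] qs].
exists (rcons c p); split; last 2 first.
- by rewrite size_rcons nc.
- move=> x; rewrite mem_rcons in_cons => /orP[/eqP->|/cs //].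
  exact: (@iter_upper_sub _ r s 0 n).
- by case: c sc {nc cs} => [|z c] /=; rewrite ?rpq // !rcons_path last_rcons => ->.
Qed.

Lemma iter_upper_nil (T : eqType) (r : rel T) (n : nat) (s : seq T) :
  chain_bound r n s -> iter n (upper r) s = [::].
Proof.
move=> rs; case E: (iter n (upper r) s) => [//|q t].
have /iter_upper_chain[c [sc nc cs]] : q \in iter n (upper r) s.
  by rewrite E mem_head.
by have := rs _ sc cs; rewrite size_rcons nc ltnn.
Qed.

(** Two points unrelated by [steep] in either direction satisfy [|dy| <= |dx|], so an antichain lies
    on a 1-Lipschitz graph over the x-axis. *)
Definition steep (R : realType) : rel (R * R) :=
  fun p q => `|q.1 - p.1| < q.2 - p.2.

Definition flat (R : realType) : rel (R * R) :=
  fun p q => `|q.2 - p.2| < q.1 - p.1.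

Lemma steep_trans (R : realType) : transitive (@steep R).
Proof.
move=> q p t; rewrite /steep => pq qt.
have -> : t.1 - p.1 = (t.1 - q.1) + (q.1 - p.1) by lra.
by apply: le_lt_trans (ler_normD _ _) _; lra.
Qed.

Lemma flat_trans (R : realType) : transitive (@flat R).
Proof.
move=> q p t; rewrite /flat => pq qt.
have -> : t.2 - p.2 = (t.2 - q.2) + (q.2 - p.2) by lra.
by apply: le_lt_trans (ler_normD _ _) _; lra.
Qed.

Lemma steep_irr (R : realType) : irreflexive (@steep R).
Proof. by move=> p; rewrite /steep !subrr normr0 ltxx. Qed.

Lemma flat_irr (R : realType) : irreflexive (@flat R).
Proof. by move=> p; rewrite /flat !subrr normr0 ltxx. Qed.

Lemma steep_flat (R : realType) (p q : R * R) :
  steep p q -> ~~ flat p q /\ ~~ flat q p.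
Proof.
rewrite /steep /flat -!leNgt => pq.
have a1 := ler_norm (q.1 - p.1); have a2 := ler_norm (q.2 - p.2).
have := ler_norm (p.1 - q.1); rewrite [`|p.1 - q.1|]distrC => a3.
by rewrite [`|p.2 - q.2|]distrC; split; lra.
Qed.

(** * Strip functions *)

Lemma dist_min (R : realType) (a b a' b' c : R) :
  `|a - a'| <= c -> `|b - b'| <= c -> `|Num.min a b - Num.min a' b'| <= c.
Proof.
rewrite !ler_norml !lterBDl => /andP[h1 h2] /andP[h3 h4].
by case: (leP a b) => ?; case: (leP a' b') => ?; apply/andP; split; lra.
Qed.

Lemma dist_max (R : realType) (a b a' b' c : R) :
  `|a - a'| <= c -> `|b - b'| <= c -> `|Num.max a b - Num.max a' b'| <= c.
Proof.
rewrite !ler_norml !lterBDl => /andP[h1 h2] /andP[h3 h4].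
by case: (leP a b) => ?; case: (leP a' b') => ?; apply/andP; split; lra.
Qed.

(** This is the height above the graph of [p.2 + |x - p.1|], the largest 1-Lipschitz function
    through [p]. A maximum of cones is thus the height above a McShane extension. *)
Definition cone (R : realType) (p : R * R) (x y : R) : R := y - p.2 - `|x - p.1|.

Definition ramp (R : realType) (s : seq (R * R)) (d x y : R) : R :=
  \big[Num.max/0]_(p <- s) (cone p x y + d).

(* The antichains of points of height [i] span 1-Lipschitz curves
   [y = c_i(x)], and [ramp _ d x y = (y - c_i(x) + d)^+].  Taking the minimum
   over [i] of [2 d i + ramp] pushes overlapping strips [|y - c_i(x)| < d]
   upwards until they are disjoint: the result still has slope one in [y] on the
   strips, but its Lipschitz constant does not depend on the number of strips. *)
Definition strip_fun (R : realType) (s : seq (R * R)) (k : nat) (d x y : R) : R :=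
  \big[Num.min/2 * d * k%:R]_(i < k)
     (2 * d * i%:R + ramp (iter i (upper (@steep R)) s) d x y).

Lemma cone_lip (R : realType) (p : R * R) (x y x' y' : R) :
  `|cone p x y - cone p x' y'| <= `|x - x'| + `|y - y'|.
Proof.
rewrite /cone; have -> : y - p.2 - `|x - p.1| - (y' - p.2 - `|x' - p.1|) =
  (y - y') - (`|x - p.1| - `|x' - p.1|) by lra.
rewrite [leRHS]addrC (le_trans (ler_normB _ _)) // lerD2l.
apply: le_trans (ler_dist_dist _ _) _.
by have -> : x - p.1 - (x' - p.1) = x - x' by lra.
Qed.

Lemma ramp_lip (R : realType) (s : seq (R * R)) (d x y x' y' : R) :
  `|ramp s d x y - ramp s d x' y'| <= `|x - x'| + `|y - y'|.
Proof.
rewrite /ramp; apply: (big_ind2 (fun a b => `|a - b| <= `|x - x'| + `|y - y'|)).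
- by rewrite subrr normr0 addr_ge0.
- by move=> *; exact: dist_max.
- move=> p _; have -> : cone p x y + d - (cone p x' y' + d) = cone p x y - cone p x' y' by lra.
  exact: cone_lip.
Qed.

Lemma strip_fun_lip (R : realType) (s : seq (R * R)) (k : nat) (d x y x' y' : R) :
  `|strip_fun s k d x y - strip_fun s k d x' y'| <= `|x - x'| + `|y - y'|.
Proof.
rewrite /strip_fun; apply: (big_ind2 (fun a b => `|a - b| <= `|x - x'| + `|y - y'|)).
- by rewrite subrr normr0 addr_ge0.
- by move=> *; exact: dist_min.
- move=> i _; set a := ramp _ _ _ _; set b := ramp _ _ _ _.
  have -> : 2 * d * i%:R + a - (2 * d * i%:R + b) = a - b by lra.
  exact: ramp_lip.
Qed.

Lemma ramp_ge0 (R : realType) (s : seq (R * R)) (d x y : R) : 0 <= ramp s d x y.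
Proof. exact: bigmax_ge_id. Qed.

Lemma strip_fun_bounds (R : realType) (s : seq (R * R)) (k : nat) (d x y : R) :
  0 <= d -> 0 <= strip_fun s k d x y <= 2 * d * k%:R.
Proof.
move=> d0; rewrite bigmin_le_id andbT; apply: le_bigmin.
  by rewrite !mulr_ge0.
by move=> i _; rewrite addr_ge0 ?ramp_ge0 // !mulr_ge0.
Qed.

Lemma ramp_attained (R : realType) (s : seq (R * R)) (d x y : R) :
  ramp s d x y = 0 \/ exists2 p, p \in s & ramp s d x y = cone p x y + d.
Proof.
rewrite /ramp big_seq; elim/big_ind: _ => [|a b|p ps]; first by left.
  by case: (leP a b).
by right; exists p.
Qed.

Lemma strip_fun_attained (R : realType) (s : seq (R * R)) (k : nat) (d x y : R) :
  strip_fun s k d x y = 2 * d * k%:R \/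
  exists2 i : nat, (i < k)%N &
    strip_fun s k d x y = 2 * d * i%:R + ramp (iter i (upper (@steep R)) s) d x y.
Proof.
rewrite /strip_fun; elim/big_ind: _ => [|a b|i _]; first by left.
  by case: (leP a b).
by right; exists i.
Qed.

(** A finite minimum of maxima selects one of its entries at each point. Locality then leaves two
    candidates for the derivative: that of a constant or that of a cone. *)
Lemma strip_fun_atom (R : realType) (s : seq (R * R)) (k : nat) (d x y : R) :
  (exists2 i : nat, (i <= k)%N & strip_fun s k d x y = 2 * d * i%:R) \/
  (exists i : nat, exists2 p, (i < k)%N && (p \in s) &
     strip_fun s k d x y = 2 * d * i%:R + (cone p x y + d)).
Proof.
have [->|[i ik ->]] := strip_fun_attained s k d x y; first by left; exists k.
have [->|[p ps ->]] := ramp_attained (iter i (upper (@steep R)) s) d x y.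
  by left; exists i; [exact: ltnW|rewrite addr0].
by right; exists i, p => //; rewrite ik (@iter_upper_sub _ (@steep R) _ 0 i).
Qed.

(** Near a point [p] of height [m], the entry of index [m] keeps the minimum below level [m + 1], so
    it is attained at some [i <= m]. As [p] belongs to layer [i] too, the ramp there is positive and
    hence given by a cone. *)
Lemma strip_fun_slope (R : realType) (s : seq (R * R)) (k : nat) (d x y : R)
    (p : R * R) :
  iter k (upper (@steep R)) s = [::] -> p \in s ->
  `|x - p.1| < d / 2 -> `|y - p.2| < d / 2 ->
  exists i : nat, exists2 q, (i < k)%N && (q \in s) &
     strip_fun s k d x y = 2 * d * i%:R + (cone q x y + d).
Proof.
move=> sk ps xp yp; have d0 : 0 < d by have := normr_ge0 (x - p.1); lra.
(* [m] is the height of [p]: the last round of [upper] that [p] survives. *)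
have [m [mk pm pm1]] : exists m, [/\ (m < k)%N, p \in iter m (upper (@steep R)) s &
    p \notin iter m.+1 (upper (@steep R)) s].
  have : p \notin iter k (upper (@steep R)) s by rewrite sk.
  elim: k {sk} => [|k IH] pk; first by rewrite ps in pk.
  have [pk'|/IH[m [mk ? ?]]] := boolP (p \in iter k (upper (@steep R)) s).
    by exists k.
  by exists m; split => //; exact: ltnW.
(* No [q] of layer [m] is steeply below [p], so [cone q] is at most 0 at [p]; moving by less than
   [d / 2] in each coordinate raises it by less than [d]. *)
have low : ramp (iter m (upper (@steep R)) s) d x y < 2 * d.
  rewrite /ramp big_seq; apply: bigmax_lt; first by lra.
  move=> q qs; have : ~~ steep q p.
    apply: contra pm1 => qp; rewrite /= mem_filter pm andbT.
    by apply/hasP; exists q.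
  rewrite /steep -leNgt /cone => qp.
  have := ler_normD (x - q.1) (p.1 - x).
  have -> : x - q.1 + (p.1 - x) = p.1 - q.1 by lra.
  rewrite [`|p.1 - x|]distrC; have := ler_norm (y - p.2); lra.
have fm : strip_fun s k d x y < 2 * d * m.+1%:R.
  apply: le_lt_trans (bigmin_le _ (Ordinal mk) _) _.
  by rewrite /= -[m.+1%:R]natr1 mulrDr mulr1 ltrD2l.
have gt i : (m < i)%N -> 2 * d * m.+1%:R <= 2 * d * i%:R.
  by move=> mi; rewrite ler_pM2l ?ler_nat //; lra.
have [E|[i ik E]] := strip_fun_attained s k d x y.
  by have := gt _ mk; rewrite -E leNgt fm.
have im : (i <= m)%N.
  rewrite leqNgt; apply/negP => /gt h; move: fm; rewrite E ltNge.
  by rewrite (le_trans h) // lerDl ramp_ge0.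
(* The cone with apex [p] itself exceeds [- d] here, both offsets being below [d / 2]. *)
have pos : 0 < ramp (iter i (upper (@steep R)) s) d x y.
  apply: (@lt_le_trans _ _ (cone p x y + d)).
    by rewrite /cone; have := ler_norm (p.2 - y); rewrite distrC; lra.
  apply: (@le_bigmax_seq _ _ _ _ 0 p xpredT (fun q => cone q x y + d)) => //.
  exact: (iter_upper_sub im pm).
have [E0|[q qs Eq]] := ramp_attained (iter i (upper (@steep R)) s) d x y.
  by rewrite E0 ltxx in pos.
by exists i, q; [rewrite ik (@iter_upper_sub _ (@steep R) _ 0 i)|rewrite E Eq].
Qed.

(** * Thin covers of null sets *)

(** The two halves of the symmetric difference are kept apart: later one bounds the mass that [E]
    misses, the other the area that [E] adds. *)
Definition approximable d (T : measurableType d) (R : realType)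
    (mu : {measure set T -> \bar R}) (G : set (set T)) (A : set T) : Prop :=
  measurable A /\ forall e : R, 0 < e ->
    exists2 E, G E & (mu (A `\` E) < e%:E)%E /\ (mu (E `\` A) < e%:E)%E.

Lemma lt_measureU2 d (T : measurableType d) (R : realType)
    (mu : {measure set T -> \bar R}) (A B C : set T) (a b : R) :
  measurable A -> measurable B -> measurable C -> A `<=` B `|` C ->
  (mu B < a%:E)%E -> (mu C < b%:E)%E -> (mu A < (a + b)%:E)%E.
Proof.
move=> mA mB mC ABC Ba Cb; apply: (@le_lt_trans _ _ (mu B + mu C)%E).
  apply: le_trans (measureU2 mu mB mC); apply: le_measure => //; rewrite inE //.
  exact: measurableU.
by rewrite EFinD lteD.
Qed.

Lemma approximable_bigsetU d (T : measurableType d) (R : realType)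
    (mu : {measure set T -> \bar R}) (G : set (set T)) (F : nat -> set T) (n : nat) :
  G `<=` measurable -> G set0 -> (forall A B, G A -> G B -> G (A `|` B)) ->
  (forall i, approximable mu G (F i)) ->
  approximable mu G (\big[setU/set0]_(i < n) F i).
Proof.
move=> Gm G0 GU aF; elim: n => [|n [mB IH]].
  rewrite big_ord0; split => // e e0; exists set0 => //.
  by rewrite setDv measure0 lte_fin.
rewrite big_ord_recr /=; have [mF aFn] := aF n.
split; first exact: measurableU.
move=> e e0; have e2 : 0 < e / 2 by lra.
have [E1 GE1 [h1 h2]] := IH _ e2; have [E2 GE2 [h3 h4]] := aFn _ e2.
have mE1 := Gm _ GE1; have mE2 := Gm _ GE2.
exists (E1 `|` E2); first exact: GU.
have -> : e = e / 2 + e / 2 by lra.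
split; [apply: lt_measureU2 h1 h3|apply: lt_measureU2 h2 h4];
  try (by repeat (apply: measurableD || apply: measurableU)).
- by move=> x [[?|?] /not_orP[? ?]]; [left|right].
- by move=> x [[?|?] /not_orP[? ?]]; [left|right].
Qed.

(** The approximable sets form a sigma-algebra. Complementation exchanges the two differences; a
    countable union is replaced by a finite one, the rest having small measure by continuity from
    above, which uses that [mu] is finite. *)
Lemma sigma_algebra_approximable d (T : measurableType d) (R : realType)
    (mu : {measure set T -> \bar R}) (G : set (set T)) (A : set T) :
  (mu setT < +oo)%E -> G `<=` measurable -> G set0 ->
  (forall A B, G A -> G B -> G (A `|` B)) -> (forall A, G A -> G (~` A)) ->
  <<s G >> A -> approximable mu G A.
Proof.
move=> muT Gm G0 GU GC; apply: smallest_sub => [|B GB]; last first.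
  split; first exact: Gm.
  by move=> e e0; exists B => //; rewrite setDv measure0 lte_fin.
split.
- by split => // e e0; exists set0 => //; rewrite setDv measure0 lte_fin.
- move=> B [mB aB]; split; first exact: measurableD.
  move=> e /aB[E GE [h1 h2]]; exists (~` E); first exact: GC.
  by rewrite !setDE !setTI !setCK (setIC _ E) (setIC _ B) -!setDE.
- move=> F aF.
  have mF i : measurable (F i) by case: (aF i).
  have mU : measurable (\bigcup_k F k) by exact: bigcupT_measurable.
  split => // e e0; have e2 : 0 < e / 2 by lra.
  pose B n := \big[setU/set0]_(i < n) F i.
  have aB n : approximable mu G (B n) by exact: approximable_bigsetU.
  pose D n := \bigcup_k F k `\` B n.
  have mD n : measurable (D n) by apply: measurableD => //; case: (aB n).
  have D0 : \bigcap_n D n = set0.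
    rewrite -subset0 => x Dx; have [k _ Fk] := (Dx 0%N I).1.
    apply: (Dx k.+1 I).2; rewrite /B -bigcup_mkord; exists k => //=.
  have cD : (mu \o D) n @[n --> \oo] --> 0%E.
    rewrite -(measure0 mu) -D0; apply: nonincreasing_cvg_mu => //.
    - apply: le_lt_trans muT; apply: le_measure; rewrite ?inE //.
    - by rewrite D0.
    - move=> n m nm; apply/subsetPset; apply: setDS.
      exact: subset_bigsetU.
  have [N _ DN] : \forall n \near \oo, (mu (D n) < (e / 2)%:E)%E.
    apply: (cD [set y | (y < (e / 2)%:E)%E]); apply: open_nbhs_nbhs.
    by split; [exact: open_ereal_lt_ereal|rewrite /= lte_fin].
  have {}DN := DN N (leqnn N).
  have [mBN /(_ _ e2)[E GE [h1 h2]]] := aB N.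
  have mE := Gm _ GE.
  exists E => //; split.
    have -> : e = e / 2 + e / 2 by lra.
    apply: lt_measureU2 DN h1; rewrite //; try exact: measurableD.
    by move=> x [Ux Ex]; have [Bx|Bx] := pselect (B N x); [right|left].
  apply: (@lt_trans _ _ (e / 2)%:E); last by rewrite lte_fin; lra.
  apply: le_lt_trans h2; apply: le_measure; rewrite ?inE; try exact: measurableD.
  by apply: setDS; rewrite /B -bigcup_mkord => x [i _ Fx]; exists i.
Qed.

(** * Dyadic cells and the sets they generate *)

Definition cell_index (R : realType) (n : nat) (x : R) : int := Num.floor (2 ^+ n * x).

Definition same_cell (R : realType) (n : nat) (z z' : plane R) : Prop :=
  cell_index n (z.1 : R) = cell_index n (z'.1 : R) /\
  cell_index n (z.2 : R) = cell_index n (z'.2 : R).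

(** These are the unions of grid cells of one level. Phrasing this as invariance under [same_cell]
    makes stability under complements immediate. *)
Definition dyadic (R : realType) : set (set (plane R)) :=
  [set E | exists n, forall z z', same_cell n z z' -> E z -> E z'].

Definition cell_side (R : realType) (n : nat) (i : int) : set (measurableTypeR R) :=
  `[i%:~R / 2 ^+ n, (i%:~R + 1) / 2 ^+ n[%classic.

Lemma exp2_gt0 (R : realType) (n : nat) : 0 < 2 ^+ n :> R.
Proof. exact: exprn_gt0. Qed.

Lemma cell_indexP (R : realType) (n : nat) (x : R) (i : int) :
  @cell_side R n i x <-> cell_index n x = i.
Proof.
rewrite /cell_side /= in_itv /= ler_pdivrMr ?exp2_gt0 // ltr_pdivlMr ?exp2_gt0 //.
rewrite mulrC; have -> : i%:~R + 1 = (i + 1)%:~R :> R by rewrite intrD.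
by rewrite -floor_eq; split=> /eqP.
Qed.

(** An integer [k] is at most [a] exactly when [2 k] is at most the floor of [2 a], so the finer
    index determines the coarser one. *)
Lemma cell_indexS (R : realType) (n : nat) (x y : R) :
  cell_index n.+1 x = cell_index n.+1 y -> cell_index n x = cell_index n y.
Proof.
rewrite /cell_index exprS -!mulrA; set a := _ * x; set b := _ * y.
wlog ab : a b / a <= b => [wl|] E.
  by have [/wl|/ltW/wl] := leP a b; [exact|move=> /(_ (esym E)) ->].
apply/eqP; rewrite eq_le le_floor //= leNgt; apply/negP => lt.
have : (Num.floor b * 2)%:~R <= 2 * a.
  rewrite -floor_ge_int E floor_ge_int intrM mulrC ler_pM2l //; exact: floor_le.
by rewrite intrM mulrC ler_pM2l // -floor_ge_int leNgt lt.
Qed.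

Lemma same_cell_le (R : realType) (n m : nat) (z z' : plane R) :
  (n <= m)%N -> same_cell m z z' -> same_cell n z z'.
Proof.
move=> /subnK <-; elim: (m - n)%N => // k IH [h1 h2].
by apply: IH; split; exact: cell_indexS.
Qed.

Lemma same_cell_sym (R : realType) (n : nat) (z z' : plane R) :
  same_cell n z z' -> same_cell n z' z.
Proof. by case=> h1 h2; split. Qed.

Lemma measurable_cell_side (R : realType) (n : nat) (i : int) :
  measurable (@cell_side R n i).
Proof. exact: measurable_itv. Qed.

Lemma dyadic_measurable (R : realType) : @dyadic R `<=` measurable.
Proof.
move=> E [n En].
(* [F ij] is the whole cell if the cell meets [E] and is empty otherwise, so the union can run over
   all pairs of integers. *)
pose F (ij : int * int) : set (plane R) := [set z | (@cell_side R n ij.1 z.1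
  /\ @cell_side R n ij.2 z.2) /\ exists2 z', E z' &
  (cell_index n (z'.1 : R), cell_index n (z'.2 : R)) = ij].
have -> : E = \bigcup_ij F ij.
  apply/seteqP; split => z.
    move=> Ez; exists (cell_index n (z.1 : R), cell_index n (z.2 : R)) => //.
    by split; [split; apply/cell_indexP|exists z].
  case=> [[i j] _ [[/cell_indexP /= h1 /cell_indexP /= h2] [z' Ez' [h3 h4]]]].
  by apply: En Ez'; split; rewrite ?h1 ?h2.
apply: countable_bigcupT_measurable => [|[i j]]; first exact: countableP.
have [ex|nex] := pselect (exists2 z', E z' &
  (cell_index n (z'.1 : R), cell_index n (z'.2 : R)) = (i, j)).
  have -> : F (i, j) = @cell_side R n i `*` @cell_side R n j.
    by apply/seteqP; split => z; [case|move=> ?; split].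
  by apply: measurableX; exact: measurable_cell_side.
by have -> : F (i, j) = set0 by apply/seteqP; split => z //; case=> _ /nex.
Qed.

Lemma dyadic0 (R : realType) : dyadic (set0 : set (plane R)).
Proof. by exists 0%N. Qed.

Lemma dyadicU (R : realType) (A B : set (plane R)) :
  dyadic A -> dyadic B -> dyadic (A `|` B).
Proof.
move=> [n An] [m Bm]; exists (maxn n m) => z z' zz' [Az|Bz]; [left|right].
  by apply: An Az; apply: same_cell_le zz'; exact: leq_maxl.
by apply: Bm Bz; apply: same_cell_le zz'; exact: leq_maxr.
Qed.

Lemma dyadicC (R : realType) (A : set (plane R)) : dyadic A -> dyadic (~` A).
Proof.
by move=> [n An]; exists n => z z' /same_cell_sym zz' nA /(An _ _ zz').
Qed.

Lemma lt_cell_index (R : realType) (x a : R) :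
  x < a -> exists n, (cell_index n x < cell_index n a)%R.
Proof.
move=> xa; have ax : 0 < a - x by lra.
have [n] : exists n : nat, 1 <= 2 ^+ n * (a - x).
  exists (Num.truncn (a - x)^-1).+1.
  rewrite -ler_pdivrMr // mul1r.
  apply: le_trans (ltW (truncnS_gt _)) _.
  by rewrite -natrX ler_nat ltnW // ltn_expl.
rewrite mulrBr => h; exists n; rewrite /cell_index.
rewrite -lezD1 floor_ge_int intrD; have := floor_le (2 ^+ n * x); lra.
Qed.

(** A ray is exhausted by the cells strictly to the left of the cell of [a], as the level grows. The
    hypothesis on [f] is met by both coordinate projections. *)
Lemma dyadic_sub_ray (R : realType) (f : plane R -> R) (a : R) :
  (forall n z z', same_cell n z z' -> cell_index n (f z) = cell_index n (f z')) ->
  <<s @dyadic R >> (f @^-1` `]-oo, a[%classic).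
Proof.
move=> fc.
have -> : f @^-1` `]-oo, a[ = \bigcup_n [set z | cell_index n (f z) < cell_index n a].
  apply/seteqP; split => z /=; rewrite in_itv /=.
    by move=> /lt_cell_index[n h]; exists n.
  case=> n _ /= h; rewrite ltNge; apply/negP => az; move: h; rewrite ltNge.
  by rewrite /cell_index le_floor // ler_pM2l ?exp2_gt0.
apply: sigma_algebra_bigcup => n; apply: sub_sigma_algebra.
by exists n => z z' /fc /= ->.
Qed.

Lemma measurable_sub_dyadic (R : realType) (A : set (plane R)) :
  measurable A -> <<s @dyadic R >> A.
Proof.
have gen (f : plane R -> R) (B : set (measurableTypeR R)) :
    (forall n z z', same_cell n z z' -> cell_index n (f z) = cell_index n (f z')) ->
    measurable B -> <<s @dyadic R >> (f @^-1` B).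
  move=> fc; rewrite [X in X B -> _](RGenInftyO.measurableE R).
  apply: (@smallest_sub _ _ _ [set B | <<s @dyadic R >> (f @^-1` B)]).
    split => [|C mC|F mF] /=.
    - by rewrite preimage_set0; exact: sigma_algebra0.
    - by rewrite setTD preimage_setC; exact: sigma_algebraC.
    - by rewrite preimage_bigcup; exact: sigma_algebra_bigcup.
  by move=> _ [x ->]; exact: dyadic_sub_ray.
apply: smallest_sub; first exact: smallest_sigma_algebra.
move=> _ [[B mB <-]|[B mB <-]]; rewrite setTI; apply: gen => //.
- by move=> n z z' [].
- by move=> n z z' [].
Qed.

(** Half-open sides make the square an exact union of cells at every level. *)
Definition square (R : realType) (M : nat) : set (plane R) :=
  (`[- M%:R, M%:R[%classic : set (measurableTypeR R)) `*` `[- M%:R, M%:R[%classic.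

Lemma measurable_square (R : realType) (M : nat) : measurable (@square R M).
Proof. by apply: measurableX; exact: measurable_itv. Qed.

Definition index_range (n M : nat) : seq int :=
  [seq i%:Z - (M * 2 ^ n)%:Z | i <- iota 0 (2 * (M * 2 ^ n))].

Lemma mem_index_range (R : realType) (n M : nat) (x : R) :
  (cell_index n x \in index_range n M) = (x \in `[- M%:R, M%:R[).
Proof.
have -> : (x \in `[- M%:R, M%:R[) =
    (- (M * 2 ^ n)%:Z <= cell_index n x < (M * 2 ^ n)%:Z).
  rewrite in_itv /= /cell_index floor_ge_int floor_lt_int intrN -!pmulrn natrM natrX.
  by rewrite -mulNr !(mulrC _ (2 ^+ n)) ler_pM2l ?ltr_pM2l ?exp2_gt0.
set N := (M * 2 ^ n)%N; apply/mapP/idP => [[i]|/andP[h1 h2]].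
  by rewrite mem_iota => /andP[_ iN] ->; lia.
exists (absz (cell_index n x + N%:Z)); last by lia.
by rewrite mem_iota; lia.
Qed.

Definition cell (R : realType) (n : nat) (ij : int * int) : set (plane R) :=
  @cell_side R n ij.1 `*` @cell_side R n ij.2.

Lemma leb2_cell (R : realType) (n : nat) (ij : int * int) :
  leb2 (@cell R n ij) = ((2 ^+ n)^-1 ^+ 2)%:E.
Proof.
rewrite /leb2 product_measure1E; try exact: measurable_cell_side.
rewrite /= /cell_side !lebesgue_measure_itv /= !lte_fin.
rewrite !ltr_pM2r ?invr_gt0 ?exp2_gt0 // !ltrDl ltr01.
have E (i : int) : (i%:~R + 1) / 2 ^+ n - i%:~R / 2 ^+ n = (2 ^+ n)^-1 :> R.
  by rewrite mulrDl mul1r addrAC subrr add0r.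
by rewrite -!EFinB -EFinM !E expr2.
Qed.

(** [P] lists the lower left corners of the cells of [E] inside the square. These cells are
    disjoint, of area [h ^+ 2] each, and contained in [E], so counting them amounts to measuring
    area. *)
Lemma dyadic_points (R : realType) (E : set (plane R)) (M : nat) :
  dyadic E ->
  exists h : R, exists2 P : seq (R * R), 0 < h &
    (((size P)%:R * h ^+ 2)%:E <= leb2 (E `&` square M))%E /\
    (forall z, E z -> square M z ->
       exists2 p, p \in P & `|(z.1 : R) - p.1| < h /\ `|(z.2 : R) - p.2| < h).
Proof.
move=> dE; have mE := dyadic_measurable dE; case: dE => n En.
pose J := [seq ij <- [seq (i, j) | i <- index_range n M, j <- index_range n M] |
  `[< exists2 z, E z & (cell_index n (z.1 : R), cell_index n (z.2 : R)) = ij >]].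
pose h : R := (2 ^+ n)^-1.
have h0 : 0 < h by rewrite invr_gt0 exp2_gt0.
have uJ : uniq J.
  apply: filter_uniq; apply: allpairs_uniq => //; last by case=> ? ? [].
  - by rewrite map_inj_uniq ?iota_uniq // => i j /(congr1 (+%R^~ (M * 2 ^ n)%:Z)); lia.
  - by rewrite map_inj_uniq ?iota_uniq // => i j /(congr1 (+%R^~ (M * 2 ^ n)%:Z)); lia.
have JP i j : (i, j) \in J -> cell n (i, j) `<=` E `&` square M.
  rewrite mem_filter => /andP[/asboolP[z' Ez' [zi zj]] /allpairsP[[i' j'] /= [iI jI [ii jj]]]].
  subst i' j'; move=> z [/cell_indexP/= i1 /cell_indexP/= j1]; split.
    by apply: En Ez'; split; congruence.
  by split; rewrite /= -(mem_index_range n); [rewrite i1|rewrite j1].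
exists h, [seq (ij.1%:~R * h, ij.2%:~R * h) | ij <- J] => //; split.
  apply: (@le_trans _ _ (leb2 (\bigcup_(ij in [set` J]) @cell R n ij))); last first.
    apply: (le_measure (@lebesgue_measure R \x @lebesgue_measure R)%E); rewrite ?inE.
    - apply: fin_bigcup_measurable => [|ij _]; first exact: finite_seq.
      by apply: measurableX; exact: measurable_cell_side.
    - by apply: measurableI => //; exact: measurable_square.
    - by apply: bigcup_sub => -[i j] /=; exact: JP.
  rewrite /leb2 (measure_fin_bigcup (@lebesgue_measure R \x @lebesgue_measure R)%E) //;
    last 3 first.
  - exact: finite_seq.
  - move=> [i j] [i' j'] _ _ [z [[/cell_indexP/= a1 /cell_indexP/= a2]
      [/cell_indexP/= a3 /cell_indexP/= a4]]].
    by congr pair; congruence.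
  - by move=> ij _; apply: measurableX; exact: measurable_cell_side.
  rewrite -fsbig_seq //= (eq_bigr (fun=> (h ^+ 2)%:E)); last first.
    by move=> ij _; exact: leb2_cell.
  by rewrite sumEFin big_const_seq iter_addr_0 count_predT size_map mulr_natl.
move=> z Ez [Q1 Q2]; pose i := cell_index n (z.1 : R); pose j := cell_index n (z.2 : R).
exists (i%:~R * h, j%:~R * h).
  apply/mapP; exists (i, j) => //; rewrite mem_filter; apply/andP; split.
    by apply/asboolP; exists z.
  by apply: allpairs_f; rewrite mem_index_range.
have H (x : R) : `|x - (cell_index n x)%:~R * h| < h.
  have /cell_indexP := erefl (cell_index n x); rewrite /cell_side /= in_itv /=.
  rewrite -/h mulrDl mul1r => /andP[h1 h2].
  by rewrite ltr_norml; apply/andP; split; lra.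
by split; exact: H.
Qed.

(** * Balls and the mass of squares *)

Lemma measurable_eball (R : realType) (x : plane R) (r : R) : measurable (eball x r).
Proof.
have [r0|r0] := ltP 0 r; last first.
  have -> : eball x r = set0; last exact: measurable0.
  by apply/seteqP; split => // y; rewrite /eball /Defs.edist /= ltNge (le_trans r0) ?sqrtr_ge0.
pose g (y : plane R) : R := (x.1 - y.1 : R) ^+ 2 + (x.2 - y.2 : R) ^+ 2.
have E y : (Defs.edist x y < r) = (g y < r ^+ 2).
  by rewrite /Defs.edist -[X in _ < X](gtr0_norm r0) -sqrtr_sqr ltr_sqrt ?exprn_gt0.
have -> : eball x r = g @^-1` `]-oo, (r ^+ 2)[.
  by apply/seteqP; split => y; rewrite /eball /= in_itv /= E.
rewrite -[X in measurable X]setTI.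
have mg : measurable_fun setT g.
  by apply: measurable_funD; apply: measurable_funX; apply: measurable_funB.
by apply: mg => //; exact: measurable_itv.
Qed.

Lemma box_eball (R : realType) (x y : plane R) (r : R) : 0 < r ->
  `|(x.1 : R) - y.1| < r / 2 -> `|(x.2 : R) - y.2| < r / 2 -> eball x r y.
Proof.
move=> r0 h1 h2; rewrite /eball /Defs.edist /=.
rewrite -[ltRHS](ger0_norm (ltW r0)) -sqrtr_sqr ltr_sqrt ?exprn_gt0 //.
rewrite -[X in X + _]real_normK ?num_real // -[X in _ + X]real_normK ?num_real //.
have n1 := normr_ge0 ((x.1 : R) - y.1); have n2 := normr_ge0 ((x.2 : R) - y.2).
set a := `|_| in h1 n1 *; set b := `|_| in h2 n2 *.
nra.
Qed.

Lemma locally_finite_square (R : realType) (mu : {measure set (plane R) -> \bar R})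
  (M : nat) : locally_finite mu -> (mu (@square R M) < +oo)%E.
Proof.
move=> lf; pose K : set (R * R)%type := `[- M%:R, M%:R]%classic `*` `[- M%:R, M%:R]%classic.
have cK : compact K by apply: compact_setX; exact: segment_compact.
pose fin (A : set (plane R)) := measurable A /\ (mu A < +oo)%E.
(* The filter of sufficiently large sets among the measurable sets of finite mass. The near-covering
   form of compactness yields a single such set containing the closed square [K]. *)
pose F : set_system (set (plane R)) :=
  [set S | exists2 A0, fin A0 & forall A, fin A -> A0 `<=` A -> S A].
have FF : Filter F.
  split.
  - by exists set0 => //; split => //; rewrite measure0.
  - move=> S T [A [mA fA] SA] [B [mB fB] TB]; exists (A `|` B) => [|C fC ABC].
      split; first exact: measurableU.
      by apply: le_lt_trans (measureU2 _ mA mB) _; rewrite lte_add_pinfty.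
    by split; [apply: SA|apply: TB] => // z ?; apply: ABC; [left|right].
  - by move=> S T ST [A fA SA]; exists A => // B fB AB; apply: ST; exact: SA.
have /compact_near_coveringP/(_ _ F (fun A x => A x) FF) := cK.
case=> [x _|A fA KA].
  have [r r0 fr] := lf x; exists (ball x (r / 2), [set A | eball x r `<=` A]).
    split; first by apply: nbhsx_ballx; rewrite divr_gt0.
    by exists (eball x r) => //; split => //; exact: measurable_eball.
  by move=> [y A] [/= [b1 b2]]; apply; exact: box_eball.
have fA' := KA _ fA (fun _ => id).
apply: le_lt_trans fA.2; apply: le_measure; rewrite ?inE.
- exact: measurable_square.
- exact: fA.1.
- move=> z [/= z1 z2]; apply: fA'; split; rewrite /= in_itv /=; [move: z1|move: z2];
     by rewrite in_itv /= => /andP[-> /ltW].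
Qed.

(** * Covers by few small boxes *)

Definition boxes (R : realType) (P : seq (R * R)) (h : R) : set (plane R) :=
  [set z | exists2 p, p \in P & `|(z.1 : R) - p.1| < h /\ `|(z.2 : R) - p.2| < h].

Lemma measurable_boxes (R : realType) (P : seq (R * R)) (h : R) :
  measurable (boxes P h).
Proof.
have -> : boxes P h = \bigcup_(p in [set` P])
    ((`]p.1 - h, p.1 + h[%classic : set (measurableTypeR R)) `*` `]p.2 - h, p.2 + h[%classic).
  by apply/seteqP; split => z [p pP [h1 h2]]; exists p => //; split;
    move: h1 h2; rewrite /= !in_itv /= -!ltr_distl // (distrC p.1) (distrC p.2).
apply: fin_bigcup_measurable => [|p _]; first exact: finite_seq.
by apply: measurableX; exact: measurable_itv.
Qed.

(** An integer square root up to a factor two: the lower bound feeds [chain_split] with [a = b = k],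
    the upper one keeps [k * h] small. *)
Lemma square_between (n : nat) : exists k, (n <= k * k <= 4 * n)%N.
Proof.
elim: n => [|n [k /andP[h1 h2]]]; first by exists 0%N.
have [E|E] := eqVneq n (k * k)%N; last by exists k; apply/andP; split; lia.
by exists k.+1; apply/andP; split; nia.
Qed.

(** The null set carrying [mu] is approximated by a dyadic set, which has small area and misses
    little mass; its cells are then divided by [chain_split]. *)
Lemma thin_cover (R : realType) (mu : {measure set (plane R) -> \bar R})
    (M : nat) (t : R) :
  locally_finite mu -> singular_wrt_leb2 mu -> 0 < t ->
  exists h : R, exists k : nat, exists P1 P2 : seq (R * R),
    [/\ 0 < h, k%:R * h <= t, chain_bound (@steep R) k P1,
        chain_bound (@flat R) k P2 &
        (mu (square M `\` (boxes P1 h `|` boxes P2 h)) <= t%:E)%E].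
Proof.
move=> lf [N [mN muN lebN]] t0.
pose mQ := @measurable_square R M.
pose lam := (@lebesgue_measure R \x @lebesgue_measure R)%E.
(* Approximating in the sum of the two restricted measures controls mass and area at once. *)
pose kappa := measure_add (mrestr mu mQ) (mrestr lam mQ).
have kE A : kappa A = (mu (A `&` square M) + lam (A `&` square M))%E.
  exact: measure_addE.
have leQ : (lam (square M) < +oo)%E.
  rewrite /lam product_measure1E; try exact: measurable_itv.
  rewrite /= !lebesgue_measure_itv /=.
  by case: ifP => _; rewrite ?mule0 ?ltry // -EFinB -EFinM ltry.
(* The bound [t] serves the uncovered mass. The square serves the cells:
   [(k h)^2 <= 4 (size P) h^2 <= 4 e <= t^2]. *)
pose e := Num.min t ((t / 2) ^+ 2).
have e0 : 0 < e by rewrite lt_min t0 exprn_gt0 ?divr_gt0.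
have [] := @sigma_algebra_approximable _ _ _ kappa (@dyadic R) N.
- by rewrite [X in (X < _)%E]kE !setTI lte_add_pinfty // locally_finite_square.
- exact: dyadic_measurable.
- exact: dyadic0.
- exact: dyadicU.
- exact: dyadicC.
- exact: measurable_sub_dyadic.
move=> _ /(_ _ e0) [E dE []].
rewrite [X in (X < _)%E -> _]kE => hNE; rewrite [X in (X < _)%E -> _]kE => hEN.
have mE := dyadic_measurable dE.
have [h [P h0 [nh cov]]] := dyadic_points M dE.
have lE : (lam (E `&` square M) < e%:E)%E.
  apply: le_lt_trans hEN.
  apply: (@le_trans _ _ (lam ((E `\` N) `&` square M) + lam N)%E).
    apply: le_trans (measureU2 _ _ _) => //; last first.
      by apply: measurableI => //; exact: measurableD.
    apply: le_measure; rewrite ?inE.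
    + exact: measurableI.
    + apply: measurableU => //; apply: measurableI => //; exact: measurableD.
    + by move=> z [Ez Qz]; have [Nz|Nz] := pselect (N z); [right|left].
  by rewrite [X in (_ + X)%E](_ : _ = 0%E) // adde0 leeDr.
have [k /andP[Pk kP]] := square_between (size P).
have [P1 [P2 [PP c1 c2]]] := chain_split (@steep_trans R) (@flat_trans R)
  (@steep_irr R) (@flat_irr R) (@steep_flat R) Pk.
exists h, k, P1, P2; split => //.
  have nhe : (size P)%:R * h ^+ 2 < e.
    by rewrite -lte_fin; apply: le_lt_trans lE.
  have kh0 : 0 <= k%:R * h by rewrite mulr_ge0 // ltW.
  rewrite -(@ler_pXn2r _ 2) ?nnegrE ?(ltW t0) // exprMn -natrX -mulnn.
  apply: (@le_trans _ _ ((4 * size P)%:R * h ^+ 2)).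
    by rewrite ler_wpM2r ?sqr_ge0 // ler_nat.
  have : e <= (t / 2) ^+ 2 by rewrite ge_min lexx orbT.
  by rewrite natrM -mulrA expr_div_n; lra.
apply: (@le_trans _ _ e%:E); last by rewrite lee_fin ge_min lexx.
apply: ltW; apply: le_lt_trans hNE.
apply: (@le_trans _ _ (mu ((N `\` E) `&` square M) + mu (~` N))%E).
  have mNE : measurable ((N `\` E) `&` square M).
    by apply: measurableI => //; exact: measurableD.
  apply: le_trans (measureU2 _ _ _) => //; last exact: measurableC.
  apply: le_measure; rewrite ?inE.
  + by apply: measurableD => //; apply: measurableU; exact: measurable_boxes.
  + by apply: measurableU => //; exact: measurableC.
  + move=> z [Qz nb]; have [Nz|Nz] := pselect (N z); [left|by right].
    split => //; split => // Ez; apply: nb.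
    have [p] := cov _ Ez Qz; rewrite PP mem_cat => /orP[pP|pP] zp.
      by left; exists p.
    by right; exists p.
by rewrite muN adde0 leeDl.
Qed.

(** * Calculus of derivations *)

Lemma le_dist_fst (R : realType) (x y : plane R) : `|(x.1 : R) - y.1| <= Defs.edist x y.
Proof. by rewrite /Defs.edist -sqrtr_sqr ler_wsqrtr // lerDl sqr_ge0. Qed.

Lemma le_dist_snd (R : realType) (x y : plane R) : `|(x.2 : R) - y.2| <= Defs.edist x y.
Proof. by rewrite /Defs.edist -sqrtr_sqr ler_wsqrtr // lerDr sqr_ge0. Qed.

Lemma lip_le_ge0 (R : realType) (C : R) (f : plane R -> R) : lip_le C f -> 0 <= C.
Proof. by move=> [/(_ (0, 0)) h _]; exact: le_trans h. Qed.

Lemma lip_le_comp (R : realType) (C : R) (f : plane R -> R) (phi : R -> R) :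
  (forall s t, `|phi s - phi t| <= `|s - t|) -> lip_le C f ->
  lip_le (`|phi 0| + C) (phi \o f).
Proof.
move=> phil [f1 f2]; split=> [x|x y] /=.
  have := phil (f x) 0; rewrite subr0 => h.
  rewrite -(subrK (phi 0) (phi (f x))) addrC (le_trans (ler_normD _ _)) // lerD2l.
  exact: le_trans (f1 x).
apply: le_trans (phil _ _) _; apply: le_trans (f2 _ _) _.
by rewrite ler_wpM2r ?sqrtr_ge0 // lerDr.
Qed.

Lemma Lipb_comp (R : realType) (f : plane R -> R) (phi : R -> R) :
  (forall s t, `|phi s - phi t| <= `|s - t|) -> Lipb f -> Lipb (fun x => phi (f x)).
Proof. by move=> phil [C fC]; exists (`|phi 0| + C); exact: lip_le_comp. Qed.

Lemma Lipb_cst (R : realType) (c : R) : Lipb (fun _ : plane R => c).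
Proof.
exists `|c|; split=> // x y.
by rewrite subrr normr0 mulr_ge0 // sqrtr_ge0.
Qed.

Lemma Lipb_lin (R : realType) (a b : R) (f g : plane R -> R) :
  Lipb f -> Lipb g -> Lipb (fun x => a * f x + b * g x).
Proof.
move=> [C [f1 f2]] [D [g1 g2]]; exists (`|a| * C + `|b| * D); split=> [x|x y].
  by apply: le_trans (ler_normD _ _) _; rewrite !normrM lerD // ler_wpM2l.
have -> : a * f x + b * g x - (a * f y + b * g y) = a * (f x - f y) + b * (g x - g y).
  by ring.
apply: le_trans (ler_normD _ _) _; rewrite !normrM mulrDl -!mulrA.
by rewrite lerD // ler_wpM2l.
Qed.

Lemma Lipb_mul (R : realType) (f g : plane R -> R) :
  Lipb f -> Lipb g -> Lipb (fun x => f x * g x).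
Proof.
move=> [C fC] [D gD]; exists (C * D + C * D).
have C0 := lip_le_ge0 fC; have D0 := lip_le_ge0 gD.
move: fC gD => [f1 f2] [g1 g2]; split=> [x|x y].
  by rewrite normrM -[leLHS]addr0 lerD ?mulr_ge0 // ler_pM.
have -> : f x * g x - f y * g y = f x * (g x - g y) + (f x - f y) * g y by ring.
apply: le_trans (ler_normD _ _) _; rewrite !normrM mulrDl lerD //.
  by rewrite -mulrA ler_pM.
by rewrite mulrAC ler_pM.
Qed.

Lemma LipbB (R : realType) (f g : plane R -> R) :
  Lipb f -> Lipb g -> Lipb (fun x => f x - g x).
Proof.
move=> lf lg; have := Lipb_lin 1 (-1) lf lg; congr Lipb.
by apply/funext => x; rewrite mul1r mulN1r.
Qed.

Lemma LipbD (R : realType) (f g : plane R -> R) :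
  Lipb f -> Lipb g -> Lipb (fun x => f x + g x).
Proof.
move=> lf lg; have := Lipb_lin 1 1 lf lg; congr Lipb.
by apply/funext => x; rewrite !mul1r.
Qed.

(** * Essentially bounded functions and integrals *)

Lemma Linfty_cst (R : realType) (mu : {measure set (plane R) -> \bar R}) (c : R) :
  Linfty mu (fun _ => c).
Proof. by split; [exact: measurable_cst|exists `|c|; apply: aeW]. Qed.

Lemma LinftyD (R : realType) (mu : {measure set (plane R) -> \bar R})
    (u v : plane R -> R) :
  Linfty mu u -> Linfty mu v -> Linfty mu (fun x => u x + v x).
Proof.
move=> [mu_ [C uC]] [mv [D vD]]; split; first exact: measurable_funD.
exists (C + D); move: uC vD; apply: filterS2 => x ux vx.
by apply: le_trans (ler_normD _ _) _; rewrite lerD.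
Qed.

Lemma LinftyM (R : realType) (mu : {measure set (plane R) -> \bar R})
    (u v : plane R -> R) :
  Linfty mu u -> Linfty mu v -> Linfty mu (fun x => u x * v x).
Proof.
move=> [mu_ [C uC]] [mv [D vD]]; split; first exact: measurable_funM.
by exists (C * D); move: uC vD; apply: filterS2 => x ux vx; rewrite normrM ler_pM.
Qed.

Lemma LinftyN (R : realType) (mu : {measure set (plane R) -> \bar R})
    (u : plane R -> R) :
  Linfty mu u -> Linfty mu (fun x => - u x).
Proof.
move=> lu; have := LinftyM (Linfty_cst mu (-1)) lu; congr Linfty.
by apply/funext => x; rewrite mulN1r.
Qed.

Lemma Linfty_indic (R : realType) (mu : {measure set (plane R) -> \bar R})
    (A : set (plane R)) : measurable A -> Linfty mu (\1_A).
Proof.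
move=> mA; split; first exact: measurable_indic.
by exists 1; apply: aeW => x /=; rewrite indicE normr_nat; case: (_ \in _) => //=; rewrite ler01.
Qed.

Lemma integrable_mul_Linfty (R : realType) (mu : {measure set (plane R) -> \bar R})
    (g u : plane R -> R) :
  mu.-integrable setT (EFin \o g) -> Linfty mu u ->
  mu.-integrable setT (fun x => (g x * u x)%:E).
Proof.
move=> ig [mu_ [C uC]]; have mg := measurable_int _ ig.
have mg' : measurable_fun setT g by apply/measurable_EFinP.
have mgu : measurable_fun setT (fun x => g x * u x) by exact: measurable_funM.
apply/integrableP; split; first exact/measurable_EFinP.
have iCg : mu.-integrable setT (fun x => (C%:E * (EFin \o g) x)%E).
  exact: integrableZl.
move/integrableP: iCg => [mCg]; apply: le_lt_trans.
apply: ae_ge0_le_integral => //.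
- by apply: measurableT_comp => //; exact/measurable_EFinP.
- exact: measurableT_comp.
- move: uC; apply: filterS => x ux _ /=.
  rewrite lee_fin !normrM mulrC ler_wpM2r //.
  exact: le_trans ux (ler_norm _).
Qed.

Lemma integrable_indic_Linfty (R : realType) (mu : {measure set (plane R) -> \bar R})
    (A : set (plane R)) (u : plane R -> R) :
  measurable A -> (mu A < +oo)%E -> Linfty mu u ->
  mu.-integrable setT (fun x => (\1_A x * u x)%:E).
Proof.
move=> mA fA lu; apply: integrable_mul_Linfty => //; apply/integrableP; split.
  by apply/measurable_EFinP; exact: measurable_indic.
rewrite (eq_integral (fun x => (\1_A x)%:E)) ?integral_indic ?setIT // => x _ /=.
by rewrite ger0_norm.
Qed.

Lemma Rintegral_ae (R : realType) (mu : {measure set (plane R) -> \bar R})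
    (u v : plane R -> R) :
  measurable_fun setT u -> measurable_fun setT v ->
  {ae mu, forall x, u x = v x} -> Rintegral mu setT u = Rintegral mu setT v.
Proof.
move=> mu_ mv uv; rewrite /Rintegral; congr fine.
apply: ae_eq_integral => //; try exact/measurable_EFinP.
by move: uv; apply: filterS => x -> _.
Qed.

Lemma Rintegral_eq0 (R : realType) (mu : {measure set (plane R) -> \bar R})
    (u : plane R -> R) :
  mu.-integrable setT (EFin \o u) -> (forall x, 0 <= u x) ->
  Rintegral mu setT u = 0 -> {ae mu, forall x, u x = 0}.
Proof.
move=> iu u0 /eqP; rewrite /Rintegral fine_eq0 ?integral_fune_fin_num // => /eqP h.
have mu_ := measurable_int _ iu.
have : ae_eq mu setT (EFin \o u) (cst 0%E).
  apply/ae_eq_integral_abs => //; rewrite -[RHS]h.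
  by apply: eq_integral => x _ /=; rewrite ger0_norm.
by apply: filterS => x /(_ I) [].
Qed.

(** * Zero sets, locality, and determination by the coordinates *)

Lemma eventually_small (R : realType) (c e : R) : 0 < e -> exists n : nat, c < 2 ^+ n * e.
Proof.
move=> e0; exists (Num.truncn (c / e)).+1; rewrite -ltr_pdivrMr //.
apply: lt_le_trans (truncnS_gt _) _.
by rewrite -natrX ler_nat ltnW // ltn_expl.
Qed.

Lemma same_cell_dist (R : realType) (n : nat) (z z' : plane R) :
  same_cell n z z' -> 2 ^+ n * Defs.edist z z' <= 2.
Proof.
have coord (x y : R) : cell_index n x = cell_index n y -> `|x - y| <= (2 ^+ n)^-1.
  move=> E; have /cell_indexP := erefl (cell_index n x).
  have /cell_indexP := esym E; rewrite E /cell_side /= !in_itv /= mulrDl mul1r.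
  by move=> /andP[a1 a2] /andP[a3 a4]; rewrite ler_norml; apply/andP; split; lra.
move=> [/coord h1 /coord h2]; rewrite mulrC -ler_pdivlMr ?exp2_gt0 //.
have p : 0 < (2 ^+ n)^-1 :> R by rewrite invr_gt0 exp2_gt0.
rewrite /Defs.edist -(@ler_pXn2r _ 2) ?nnegrE ?sqrtr_ge0 ?mulr_ge0 ?(ltW p) //.
rewrite sqr_sqrtr ?addr_ge0 ?sqr_ge0 //.
rewrite -[X in X + _]real_normK ?num_real // -[X in _ + X]real_normK ?num_real //.
have n1 := normr_ge0 ((z.1 : R) - z'.1); have n2 := normr_ge0 ((z.2 : R) - z'.2).
set a := `|_| in h1 n1 *; set b := `|_| in h2 n2 *; set t := _^-1 in h1 h2 p *.
nra.
Qed.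

(** Where [h] is nonzero, the Lipschitz bound excludes zeros from a small enough cell around the
    point; so the complement is a countable union of dyadic sets. *)
Lemma measurable_zero_set (R : realType) (h : plane R -> R) :
  Lipb h -> measurable [set z | h z = 0].
Proof.
move=> [C hC]; have C0 := lip_le_ge0 hC.
pose U n := [set z | forall z', same_cell n z z' -> h z' <> 0].
rewrite -[X in measurable X]setCK; apply: measurableC.
have -> : ~` [set z | h z = 0] = \bigcup_n U n.
  apply/seteqP; split => z /=; last by case=> n _ /(_ z); apply.
  move=> hz; have hz0 : 0 < `|h z| by rewrite normr_gt0; apply/eqP.
  have [n nh] := eventually_small (C * 2) hz0.
  exists n => // z' /same_cell_dist zz' hz'.
  have := hC.2 z z'; rewrite hz' subr0 leNgt => /negP; apply.
  rewrite -(ltr_pM2l (exp2_gt0 R n)) (le_lt_trans _ nh) // mulrCA.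
  by rewrite ler_wpM2l.
apply: bigcupT_measurable => n; apply: dyadic_measurable; exists n.
move=> z z' [h1 h2] Uz z'' [h3 h4]; apply: Uz; split; congruence.
Qed.

Lemma deriv0 (R : realType) (mu : {measure set (plane R) -> \bar R})
    (D : (plane R -> R) -> plane R -> R) :
  derivation mu D -> {ae mu, forall x, D (fun _ => 0) x = 0}.
Proof.
move=> [_ lin _ _]; have l0 := Lipb_cst (0 : R).
have := lin 0 0 _ _ l0 l0; apply: filterS => x.
by rewrite (_ : (fun _ => _) = fun=> 0) => [->|]; [|apply/funext => y]; rewrite !mul0r addr0.
Qed.

Lemma derivB (R : realType) (mu : {measure set (plane R) -> \bar R})
    (D : (plane R -> R) -> plane R -> R) (f g : plane R -> R) :
  derivation mu D -> Lipb f -> Lipb g ->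
  {ae mu, forall x, D (fun y => f y - g y) x = D f x - D g x}.
Proof.
move=> [_ lin _ _] lf lg; have := lin 1 (-1) _ _ lf lg; apply: filterS => x.
rewrite mul1r mulN1r => <-; congr (D _ x).
by apply/funext => y; rewrite mul1r mulN1r.
Qed.

Lemma derivD (R : realType) (mu : {measure set (plane R) -> \bar R})
    (D : (plane R -> R) -> plane R -> R) (f g : plane R -> R) :
  derivation mu D -> Lipb f -> Lipb g ->
  {ae mu, forall x, D (fun y => f y + g y) x = D f x + D g x}.
Proof.
move=> [_ lin _ _] lf lg; have := lin 1 1 _ _ lf lg; apply: filterS => x.
rewrite !mul1r => <-; congr (D _ x).
by apply/funext => y; rewrite !mul1r.
Qed.

Lemma derivZ (R : realType) (mu : {measure set (plane R) -> \bar R})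
    (D : (plane R -> R) -> plane R -> R) (a : R) (f : plane R -> R) :
  derivation mu D -> Lipb f ->
  {ae mu, forall x, D (fun y => a * f y) x = a * D f x}.
Proof.
move=> [_ lin _ _] lf; have := lin a 0 _ _ lf lf; apply: filterS => x.
rewrite mul0r addr0 => <-; congr (D _ x).
by apply/funext => y; rewrite mul0r addr0.
Qed.

(** The Leibniz rule for [1 * 1] makes the derivative of 1 equal to twice itself. *)
Lemma deriv_cst (R : realType) (mu : {measure set (plane R) -> \bar R})
    (D : (plane R -> R) -> plane R -> R) (c : R) :
  derivation mu D -> {ae mu, forall x, D (fun _ => c) x = 0}.
Proof.
move=> dD; have l1 := Lipb_cst (1 : R).
have := derivZ c dD l1; case: (dD) => _ _ leib _; have := leib _ _ l1 l1.
apply: filterS2 => x; rewrite (_ : (fun _ => 1 * 1) = fun=> 1); last first.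
  by apply/funext => y; rewrite mulr1.
rewrite (_ : (fun _ => c * 1) = fun=> c); last by apply/funext => y; rewrite mulr1.
by rewrite mul1r => E ->; rewrite (_ : D (fun=> 1) x = 0) ?mulr0 //; lra.
Qed.

Lemma net_cvg_cst (R : realType) (I : Type) (le : I -> I -> Prop) (c l : R) :
  directed_set le -> net_cvg le (fun _ => c) l -> c = l.
Proof.
move=> [_ refl _ _] cv; apply/eqP; rewrite -subr_eq0 -normr_le0 leNgt.
apply/negP => /cv[i /(_ _ (refl i))]; by rewrite ltxx.
Qed.

(** Test the weak-* convergence against [D f] restricted to [A], integrable since [A] has finite
    mass. The integrals along the net vanish and their limit is the integral of [(D f)^2] over
    [A]. *)
Lemma deriv_net_eq0 (R : realType) (mu : {measure set (plane R) -> \bar R})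
    (D : (plane R -> R) -> plane R -> R) (A : set (plane R))
    (I : Type) (le : I -> I -> Prop) (fa : I -> plane R -> R) (f : plane R -> R) (C : R) :
  derivation mu D -> measurable A -> (mu A < +oo)%E ->
  directed_set le -> (forall i, lip_le C (fa i)) -> Lipb f ->
  (forall x, net_cvg le (fun i => fa i x) (f x)) ->
  (forall i, {ae mu, forall x, A x -> D (fa i) x = 0}) ->
  {ae mu, forall x, A x -> D f x = 0}.
Proof.
move=> [DL _ _ wk] mA fA dle faC lf cv Da.
have lD := DL _ lf; have ig := integrable_indic_Linfty mA fA lD.
have := wk I le fa f C dle faC lf cv _ ig.
have E0 i : Rintegral mu setT (fun x => \1_A x * D f x * D (fa i) x) = 0.
  rewrite (@Rintegral_ae _ _ _ (fun=> 0)).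
  - by rewrite /Rintegral integral0.
  - apply: measurable_funM; last by case: (DL _ (ex_intro _ C (faC i))).
    by apply: measurable_funM; [exact: measurable_indic|case: lD].
  - exact: measurable_cst.
  - move: (Da i); apply: filterS => x h; rewrite indicE.
    have [/set_mem xA|_] := boolP (x \in A); last by rewrite !mul0r.
    by rewrite h // mulr0.
rewrite (_ : (fun i => _) = fun=> 0); last by apply/funext => i; exact: E0.
move=> /(net_cvg_cst dle)/esym/Rintegral_eq0 H.
have : {ae mu, forall x, \1_A x * D f x * D f x = 0}.
  apply: H.
    exact: integrable_mul_Linfty.
  by move=> x; rewrite -mulrA mulr_ge0 // -expr2 sqr_ge0.
apply: filterS => x; rewrite indicE => h /mem_set xA; move: h; rewrite xA mul1r.
by move=> /eqP; rewrite mulf_eq0 orbb => /eqP.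
Qed.

Lemma directed_leq : directed_set (fun n m : nat => (n <= m)%N : Prop).
Proof.
split; first by exists 0%N.
- exact: leqnn.
- by move=> i j k ij jk; exact: leq_trans ij jk.
- by move=> i j; exists (maxn i j); rewrite leq_maxl leq_maxr.
Qed.

(** For [e >= 0] this is [t] minus its projection onto [[-e, e]]. *)
Definition soft_threshold (R : realType) (e t : R) : R :=
  Num.max (t - e) 0 + Num.min (t + e) 0.

Lemma soft_threshold_lip (R : realType) (e s t : R) : 0 <= e ->
  `|soft_threshold e s - soft_threshold e t| <= `|s - t|.
Proof.
move=> e0; rewrite /soft_threshold.
have h : -`|s - t| <= s - t <= `|s - t| by rewrite -ler_norml.
rewrite ler_norml; set d := `|_| in h *.
by case: (leP (s - e) 0) => ?; case: (leP (t - e) 0) => ?; case: (leP (s + e) 0) => ?;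
   case: (leP (t + e) 0) => ?; lra.
Qed.

Lemma soft_threshold_dist (R : realType) (e t : R) : 0 <= e ->
  `|soft_threshold e t - t| <= e.
Proof.
move=> e0; rewrite /soft_threshold ler_norml.
by case: (leP (t - e) 0) => ?; case: (leP (t + e) 0) => ?; lra.
Qed.

(* The soft threshold of [h] at level [e] is supported where
   [g = (e - |h|)^+] vanishes; by the Leibniz rule its derivative vanishes on
   [{h = 0}], where [g = e].  Let [e] tend to 0. *)
Lemma deriv_zero_set (R : realType) (mu : {measure set (plane R) -> \bar R})
    (D : (plane R -> R) -> plane R -> R) (Q : set (plane R)) (h : plane R -> R) :
  derivation mu D -> measurable Q -> (mu Q < +oo)%E -> Lipb h ->
  {ae mu, forall x, Q x -> h x = 0 -> D h x = 0}.
Proof.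
move=> dD mQ fQ lh; have mZ := measurable_zero_set lh.
pose A := Q `&` [set z | h z = 0].
have mA : measurable A by exact: measurableI.
have fA : (mu A < +oo)%E.
  by apply: le_lt_trans fQ; apply: le_measure; rewrite ?inE //; exact: subIsetl.
pose e n : R := n.+1%:R^-1.
have e0 n : 0 < e n by rewrite invr_gt0.
have e0' n : 0 <= e n by exact: ltW.
have s0 n : soft_threshold (e n) 0 = 0.
  by rewrite /soft_threshold sub0r add0r max_r ?min_r ?oppr_le0 // addr0.
have [C hC] := lh.
suff : {ae mu, forall x, A x -> D h x = 0}.
  by apply: filterS => x H Qx hx; apply: H; split.
apply: (deriv_net_eq0 (fa := fun n x => soft_threshold (e n) (h x)) (C := C)
  dD mA fA directed_leq) => //.
- move=> n; have := lip_le_comp (fun s t => soft_threshold_lip s t (e0' n)) hC.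
  by rewrite s0 normr0 add0r.
- move=> x d d0; exists (Num.truncn d^-1) => i di.
  apply: le_lt_trans (soft_threshold_dist _ (e0' i)) _.
  rewrite /e invf_plt ?posrE //; apply: lt_le_trans (truncnS_gt _) _.
  by rewrite ler_nat.
move=> n; pose g x := Num.max (e n - `|h x|) 0.
have lg : Lipb g.
  apply: (Lipb_comp (phi := fun t => Num.max (e n - `|t|) 0)) => // s t.
  apply: dist_max; last by rewrite subrr normr0.
  rewrite (_ : _ - _ = `|t| - `|s|); last by ring.
  rewrite distrC; exact: ler_dist_dist.
have ls : Lipb (fun x => soft_threshold (e n) (h x)).
  by apply: Lipb_comp lh => s t; exact: soft_threshold_lip.
have [_ _ leib _] := dD.
have := leib _ _ ls lg; have := deriv0 dD; apply: filterS2 => x z.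
rewrite (_ : (fun y => _) = fun=> 0); last first.
  apply/funext => y; rewrite /g /soft_threshold.
  have := e0 n; case: (leP 0 (h y)) => hy; rewrite ?(ger0_norm hy) ?(ltr0_norm hy).
    rewrite (min_r (_ : 0 <= h y + e n)); last by rewrite addr_ge0 // ltW.
    by case: (leP (h y - e n) 0) => ?; case: (leP (e n - h y) 0) => ? ?; nra.
  rewrite (max_r (_ : h y - e n <= 0)); last by have := e0 n; lra.
  by case: (leP (h y + e n) 0) => ?; case: (leP (e n - - h y) 0) => ? ?; nra.
rewrite z => + [_ hx]; rewrite hx s0 mul0r add0r /g hx normr0 subr0 max_l //.
by move=> /esym/eqP; rewrite mulf_eq0 gt_eqF //= => /eqP.
Qed.

Lemma ae_and (R : realType) (mu : {measure set (plane R) -> \bar R})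
    (P Q : plane R -> Prop) :
  {ae mu, forall x, P x} -> {ae mu, forall x, Q x} -> {ae mu, forall x, P x /\ Q x}.
Proof. by apply: filterS2. Qed.

Lemma deriv_local (R : realType) (mu : {measure set (plane R) -> \bar R})
    (D : (plane R -> R) -> plane R -> R) (Q : set (plane R)) (f g : plane R -> R) :
  derivation mu D -> measurable Q -> (mu Q < +oo)%E -> Lipb f -> Lipb g ->
  {ae mu, forall x, Q x -> f x = g x -> D f x = D g x}.
Proof.
move=> dD mQ fQ lf lg.
have := deriv_zero_set dD mQ fQ (LipbB lf lg); have := derivB dD lf lg.
apply: filterS2 => x -> H Qx fg; apply/eqP; rewrite -subr_eq0; apply/eqP.
by apply: H => //; rewrite fg subrr.
Qed.

Lemma ae_all_mem (R : realType) (mu : {measure set (plane R) -> \bar R}) (T : eqType)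
    (s : seq T) (P : T -> plane R -> Prop) :
  (forall p, p \in s -> {ae mu, forall x, P p x}) ->
  {ae mu, forall x, forall p, p \in s -> P p x}.
Proof.
elim: s => [|q s IH] H; first by apply: aeW.
have h1 : {ae mu, forall x, P q x} by apply: H; rewrite mem_head.
have h2 : {ae mu, forall x, forall p, p \in s -> P p x}.
  by apply: IH => p ps; apply: H; rewrite in_cons ps orbT.
move: h1 h2; apply: filterS2 => x Pq Ps p; rewrite in_cons => /orP[/eqP-> //|]; exact: Ps.
Qed.

(** For weak-* continuity the bounded coefficients are moved into the test function, which stays
    integrable. *)
Lemma derivation_comb (R : realType) (mu : {measure set (plane R) -> \bar R})
    (D1 D2 : (plane R -> R) -> plane R -> R) (a b : plane R -> R) :
  derivation mu D1 -> derivation mu D2 -> Linfty mu a -> Linfty mu b ->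
  derivation mu (fun f x => a x * D1 f x + b x * D2 f x).
Proof.
move=> [L1 lin1 leib1 wk1] [L2 lin2 leib2 wk2] la lb; split.
- by move=> f lf; apply: LinftyD; apply: LinftyM => //; [exact: L1|exact: L2].
- move=> r s f g lf lg; have := lin1 r s _ _ lf lg; have := lin2 r s _ _ lf lg.
  by apply: filterS2 => x -> ->; ring.
- move=> f g lf lg; have := leib1 _ _ lf lg; have := leib2 _ _ lf lg.
  by apply: filterS2 => x -> ->; ring.
- move=> I le fa f C dle faC lf cv g ig.
  have iga := integrable_mul_Linfty ig la; have igb := integrable_mul_Linfty ig lb.
  have E h : Lipb h -> Rintegral mu setT (fun x => g x * (a x * D1 h x + b x * D2 h x)) =
      Rintegral mu setT (fun x => g x * a x * D1 h x) +
      Rintegral mu setT (fun x => g x * b x * D2 h x).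
    move=> lh; rewrite -RintegralD //.
    + by congr Rintegral; apply/funext => x; ring.
    + by apply: integrable_mul_Linfty => //; exact: L1.
    + by apply: integrable_mul_Linfty => //; exact: L2.
  move=> e e0; have e2 : 0 < e / 2 by lra.
  have [_ _ _ dir] := dle.
  have [i1 H1] := wk1 I le fa f C dle faC lf cv _ iga _ e2.
  have [i2 H2] := wk2 I le fa f C dle faC lf cv _ igb _ e2.
  have [i0 [i10 i20]] := dir i1 i2; exists i0 => i i0i.
  have [_ _ tr _] := dle.
  rewrite !E //; last by exists C.
  have := H1 i (tr _ _ _ i10 i0i); have := H2 i (tr _ _ _ i20 i0i).
  set u := Rintegral _ _ _; set v := Rintegral _ _ _.
  set u' := Rintegral _ _ _; set v' := Rintegral _ _ _ => h1 h2.
  rewrite (_ : _ - _ = (u' - v') + (u - v)); last by ring.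
  by apply: le_lt_trans (ler_normD _ _) _; lra.
Qed.

(** At each point the absolute value agrees with [X - c] or with [c - X], and locality applies to
    either. *)
Lemma deriv_abs_eq0 (R : realType) (mu : {measure set (plane R) -> \bar R})
    (D : (plane R -> R) -> plane R -> R) (Q : set (plane R)) (X : plane R -> R) (c : R) :
  derivation mu D -> measurable Q -> (mu Q < +oo)%E -> Lipb X ->
  {ae mu, forall x, Q x -> D X x = 0} ->
  {ae mu, forall x, Q x -> D (fun z => `|X z - c|) x = 0}.
Proof.
move=> dD mQ fQ lX DX; have lc := Lipb_cst c.
have lXc := LipbB lX lc; have lcX := LipbB lc lX.
have la : Lipb (fun z => `|X z - c|).
  by apply: (Lipb_comp (phi := fun t => `|t|)) => // s t; exact: ler_dist_dist.
have := ae_and (ae_and (deriv_local dD mQ fQ la lXc) (deriv_local dD mQ fQ la lcX))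
  (ae_and (ae_and (derivB dD lX lc) (derivB dD lc lX)) (ae_and DX (deriv_cst c dD))).
apply: filterS => x [[H1 H2] [[E1 E2] [/(_ _) EX Ec]]] Qx.
have [cX|Xc] := leP 0 (X x - c).
  by rewrite H1 ?ger0_norm // E1 Ec subr0 EX.
by rewrite H2 ?ltr0_norm ?opprB // E2 Ec sub0r EX ?oppr0.
Qed.

Lemma edist_le (R : realType) (x y : plane R) :
  Defs.edist x y <= `|(x.1 : R) - y.1| + `|(x.2 : R) - y.2|.
Proof.
rewrite /Defs.edist -(@ler_pXn2r _ 2) ?nnegrE ?sqrtr_ge0 ?addr_ge0 //.
rewrite sqr_sqrtr ?addr_ge0 ?sqr_ge0 //.
rewrite -[X in X + _ <= _]real_normK ?num_real // -[X in _ + X <= _]real_normK ?num_real //.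
have n1 := normr_ge0 ((x.1 : R) - y.1); have n2 := normr_ge0 ((x.2 : R) - y.2).
set a := `|_| in n1 *; set b := `|_| in n2 *; nra.
Qed.

Definition nonexpansive (R : realType) (X : plane R -> R) : Prop :=
  forall z z', `|X z - X z'| <= Defs.edist z z'.

Lemma directed_subset (T : eqType) : directed_set (fun s t : seq T => {subset s <= t}).
Proof.
split; first by exists [::].
- by move=> s x.
- by move=> s t u st tu x /st /tu.
- by move=> s t; exists (s ++ t); split => x xs; rewrite mem_cat xs ?orbT.
Qed.

(* By McShane's formula [f (X, Y)] is the infimum over the points [p] of the
   functions [f p + C |X - p1| + C |Y - p2|], whose derivatives vanish. *)
Lemma deriv_eq0_of_coord (R : realType) (mu : {measure set (plane R) -> \bar R})
    (D : (plane R -> R) -> plane R -> R) (Q : set (plane R)) (X Y : plane R -> R)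
    (f : plane R -> R) :
  derivation mu D -> measurable Q -> (mu Q < +oo)%E ->
  Lipb X -> Lipb Y -> nonexpansive X -> nonexpansive Y ->
  (forall z, Q z -> X z = z.1 /\ Y z = z.2) ->
  {ae mu, forall x, Q x -> D X x = 0} -> {ae mu, forall x, Q x -> D Y x = 0} ->
  Lipb f -> {ae mu, forall x, Q x -> D f x = 0}.
Proof.
move=> dD mQ fQ lX lY nX nY XY DX DY lf.
have [C fC] := lf; have C0 := lip_le_ge0 fC.
have [f1 f2] := fC.
pose atom (p : plane R) z := C * (`|X z - p.1| + `|Y z - p.2|) + f p.
(* The base value [C] keeps the minima bounded and, being an upper bound of [f], does not alter the
   infimum. *)
pose F (s : seq (plane R)) z := \big[Num.min/C]_(p <- s) atom p z.
have lax c : Lipb (fun z => `|X z - c|).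
  apply: (Lipb_comp (phi := fun t => `|t - c|)) => // s t.
  by apply: le_trans (ler_dist_dist _ _) _; rewrite opprB addrA subrK.
have lay c : Lipb (fun z => `|Y z - c|).
  apply: (Lipb_comp (phi := fun t => `|t - c|)) => // s t.
  by apply: le_trans (ler_dist_dist _ _) _; rewrite opprB addrA subrK.
have ls p : Lipb (fun z => `|X z - p.1| + `|Y z - p.2|) by exact: LipbD.
have lCs p : Lipb (fun z => C * (`|X z - p.1| + `|Y z - p.2|)).
  by apply: Lipb_mul => //; exact: Lipb_cst.
have latom p : Lipb (atom p) by apply: LipbD => //; exact: Lipb_cst.
have Datom p : {ae mu, forall x, Q x -> D (atom p) x = 0}.
  have := ae_and (ae_and (derivD dD (lCs p) (Lipb_cst (f p))) (derivZ C dD (ls p)))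
   (ae_and (ae_and (derivD dD (lax p.1) (lay p.2)) (deriv_cst (f p) dD))
     (ae_and (deriv_abs_eq0 p.1 dD mQ fQ lX DX) (deriv_abs_eq0 p.2 dD mQ fQ lY DY))).
  apply: filterS => x [[E1 E2] [[E3 E4] [E5 E6]]] Qx.
  by rewrite E1 E2 E3 E4 E5 // E6 // !addr0 mulr0.
have atom_lip p z z' : `|atom p z - atom p z'| <= 2 * C * Defs.edist z z'.
  rewrite /atom (_ : _ - _ = C * ((`|X z - p.1| - `|X z' - p.1|) +
     (`|Y z - p.2| - `|Y z' - p.2|))); last by ring.
  rewrite normrM ger0_norm // [2 * C]mulrC -mulrA ler_wpM2l // mulr_natl mulr2n.
  apply: le_trans (ler_normD _ _) _; apply: lerD.
    apply: le_trans (ler_dist_dist _ _) _.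
    by rewrite (_ : _ - _ = X z - X z') //; ring.
  apply: le_trans (ler_dist_dist _ _) _.
  by rewrite (_ : _ - _ = Y z - Y z') //; ring.
have Flip s : lip_le (2 * C) (F s).
  split=> [z|z z']; last first.
    rewrite /F; apply: (big_ind2 (fun a b => `|a - b| <= 2 * C * Defs.edist z z')) => //.
      by rewrite subrr normr0 !mulr_ge0 // sqrtr_ge0.
    by move=> *; exact: dist_min.
  have h1 : F s z <= C by exact: bigmin_le_id.
  have h2 : - C <= F s z.
    apply: le_bigmin => [|p _]; first by lra.
    have : - C <= f p by have := f1 p; rewrite ler_norml => /andP[].
    have : 0 <= C * (`|X z - p.1| + `|Y z - p.2|) by rewrite mulr_ge0 // addr_ge0.
    by rewrite /atom; lra.
  by rewrite ler_norml; apply/andP; split; lra.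
(* [G] is what the minima converge to; it agrees with [f] on [Q], so locality returns from [G] to
   [f] at the end. *)
pose G z := f (X z, Y z).
have lG : Lipb G.
  exists (2 * C); split=> [z|z z']; first by apply: le_trans (f1 _) _; lra.
  apply: le_trans (f2 _ _) _; rewrite [2 * C]mulrC -mulrA ler_wpM2l //.
  apply: le_trans (edist_le _ _) _; rewrite mulr_natl mulr2n.
  by apply: lerD; [have := nX z z'|have := nY z z'].
(* Once the list contains [(X z, Y z)] the minimum is exact. The net of finite lists is therefore
   eventually constant at each point. *)
have FG z s : (X z, Y z) \in s -> F s z = G z.
  move=> zs; apply/le_anti/andP; split.
    apply: (@bigmin_inf_seq _ _ _ _ _ (X z, Y z)) => //.
    by rewrite /atom /= !subrr normr0 addr0 mulr0 add0r.
  apply: le_bigmin => [|p _]; first by have := f1 (X z, Y z); rewrite ler_norml => /andP[].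
  rewrite /atom -lerBlDr; apply: le_trans (ler_norm _) _; apply: le_trans (f2 _ _) _.
  by rewrite ler_wpM2l //; exact: edist_le.
have DG : {ae mu, forall x, Q x -> D G x = 0}.
  apply: (deriv_net_eq0 (fa := F) (C := 2 * C) dD mQ fQ (@directed_subset (plane R))) => //.
    move=> z e e0; exists [:: (X z, Y z)] => s sub.
    by rewrite FG ?subrr ?normr0 //; apply: sub; rewrite mem_head.
  move=> s; have lF : Lipb (F s) by exists (2 * C).
  have h1 := ae_all_mem (s := s) (fun p _ => Datom p).
  have h2 := ae_all_mem (s := s) (fun p _ => deriv_local dD mQ fQ lF (latom p)).
  have h3 := ae_and (deriv_local dD mQ fQ lF (Lipb_cst C)) (deriv_cst C dD).
  move: (ae_and (ae_and h1 h2) h3); apply: filterS => x [[H1 H2] [H3 H4]] Qx.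
  have [E|[p ps E]] : F s x = C \/ exists2 p, p \in s & F s x = atom p x.
    rewrite /F big_seq; elim/big_ind: _ => [|a b|p ps]; first by left.
      by case: (leP a b).
    by right; exists p.
  - by rewrite H3.
  - by rewrite (H2 p) // H1.
have := ae_and DG (deriv_local dD mQ fQ lG lf); apply: filterS => x [H1 H2] Qx.
by rewrite -H2 // ?H1 // /G; have [-> ->] := XY _ Qx; rewrite -surjective_pairing.
Qed.

(** * Mass of thin covers *)

(** Each cone is [Y - |X - p.1|] up to a constant, so its derivative is [D Y] as soon as [D X]
    vanishes. There are finitely many cones and levels, so locality holds for all of them off one
    null set. *)
Lemma deriv_strip_fun (R : realType) (mu : {measure set (plane R) -> \bar R})
    (D : (plane R -> R) -> plane R -> R) (Q : set (plane R)) (X Y : plane R -> R)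
    (s : seq (R * R)) (k : nat) (d : R) :
  derivation mu D -> measurable Q -> (mu Q < +oo)%E -> Lipb X -> Lipb Y ->
  {ae mu, forall x, Q x -> D X x = 0} ->
  iter k (upper (@steep R)) s = [::] ->
  Lipb (fun z => strip_fun s k d (X z) (Y z)) ->
  {ae mu, forall x, Q x ->
    (D (fun z => strip_fun s k d (X z) (Y z)) x = 0 \/
     D (fun z => strip_fun s k d (X z) (Y z)) x = D Y x) /\
    (forall p, p \in s -> `|X x - p.1| < d / 2 -> `|Y x - p.2| < d / 2 ->
     D (fun z => strip_fun s k d (X z) (Y z)) x = D Y x)}.
Proof.
move=> dD mQ fQ lX lY DX sk; set F := (fun z => _) => lF.
pose atom (i : nat) (p : R * R) z := 2 * d * i%:R + (cone p (X z) (Y z) + d).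
have lax c : Lipb (fun z => `|X z - c|).
  apply: (Lipb_comp (phi := fun t => `|t - c|)) => // u t.
  by apply: le_trans (ler_dist_dist _ _) _; rewrite opprB addrA subrK.
have lYX c : Lipb (fun z => Y z - `|X z - c|) by exact: LipbB.
have atomE i p : atom i p = fun z => (Y z - `|X z - p.1|) + (2 * d * i%:R + d - p.2).
  by apply/funext => z; rewrite /atom /cone; ring.
have latom i p : Lipb (atom i p).
  by rewrite atomE; apply: LipbD => //; exact: Lipb_cst.
have Datom i p : {ae mu, forall x, Q x -> D (atom i p) x = D Y x}.
  rewrite atomE; set c := _ - p.2.
  have := ae_and (ae_and (derivD dD (lYX p.1) (Lipb_cst c)) (derivB dD lY (lax p.1)))
    (ae_and (deriv_cst c dD) (deriv_abs_eq0 p.1 dD mQ fQ lX DX)).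
  by apply: filterS => x [[E1 E2] [E3 E4]] Qx; rewrite E1 E2 E3 E4 // subr0 addr0.
have h1 : {ae mu, forall x, forall i, i \in iota 0 k -> forall p, p \in s ->
    (Q x -> D (atom i p) x = D Y x) /\ (Q x -> F x = atom i p x -> D F x = D (atom i p) x)}.
  apply: ae_all_mem => i _; apply: ae_all_mem => p _; apply: ae_and; first exact: Datom.
  exact: deriv_local.
(* Index [k] is included because [2 * d * k] is the base value of the minimum. *)
have h2 : {ae mu, forall x, forall i, i \in iota 0 k.+1 ->
    D (fun=> 2 * d * i%:R) x = 0 /\
    (Q x -> F x = 2 * d * i%:R -> D F x = D (fun=> 2 * d * i%:R) x)}.
  apply: ae_all_mem => i _; apply: ae_and; first exact: deriv_cst.
  by apply: deriv_local => //; exact: Lipb_cst.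
move: (ae_and h1 h2); apply: filterS => x [H1 H2] Qx.
have up i p : (i < k)%N && (p \in s) -> F x = atom i p x -> D F x = D Y x.
  move=> /andP[ik ps] E; have ki : i \in iota 0 k by rewrite mem_iota.
  by have [A1 A2] := H1 i ki p ps; rewrite A2 // A1.
split=> [|p ps xp yp].
  have [[i ik E]|[i [p ip E]]] := strip_fun_atom s k d (X x) (Y x).
    have ki : i \in iota 0 k.+1 by rewrite mem_iota.
    by left; have [A1 A2] := H2 i ki; rewrite A2.
  by right; exact: up E.
by have [i [q iq E]] := strip_fun_slope sk ps xp yp; exact: up E.
Qed.

Lemma Rintegral_ae_le (R : realType) (mu : {measure set (plane R) -> \bar R})
    (u v : plane R -> R) :
  mu.-integrable setT (EFin \o u) -> mu.-integrable setT (EFin \o v) ->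
  {ae mu, forall x, u x <= v x} -> Rintegral mu setT u <= Rintegral mu setT v.
Proof.
move=> iu iv uv; rewrite -subr_ge0 -RintegralB //.
have mB : measurable_fun setT (fun x => v x - u x).
  by apply: measurable_funB; apply/measurable_EFinP;
    [exact: measurable_int iv|exact: measurable_int iu].
rewrite (@Rintegral_ae _ _ _ (fun x => `|v x - u x|)) //.
- by apply: Rintegral_ge0.
- exact: measurableT_comp.
- by move: uv; apply: filterS => x uv; rewrite ger0_norm // subr_ge0.
Qed.

(* If the boxes around [s] carried a fixed amount of the [D Y]-mass with [k h]
   arbitrarily small, the corresponding strip functions would tend to [0] with
   bounded Lipschitz constants while their derivatives would not. *)
Lemma thin_boxes_mass (R : realType) (mu : {measure set (plane R) -> \bar R})
    (D : (plane R -> R) -> plane R -> R) (Q : set (plane R)) (X Y : plane R -> R) (e : R) :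
  derivation mu D -> measurable Q -> (mu Q < +oo)%E -> Lipb X -> Lipb Y ->
  nonexpansive X -> nonexpansive Y ->
  {ae mu, forall x, Q x -> D X x = 0} -> {ae mu, forall x, Q x -> 0 <= D Y x} ->
  0 < e -> exists2 t : R, 0 < t &
  forall (s : seq (R * R)) (k : nat) (h : R) (E : set (plane R)),
    0 < h -> k%:R * h <= t -> chain_bound (@steep R) k s -> measurable E -> E `<=` Q ->
    (forall z, E z -> exists2 p, p \in s & `|X z - p.1| < h /\ `|Y z - p.2| < h) ->
    Rintegral mu setT (fun x => \1_E x * D Y x) <= e.
Proof.
move=> dD mQ fQ lX lY nX nY DX DY e0.
pose good (i : seq (R * R) * nat * R * set (plane R)) (t : R) :=
  let: (s, k, h, E) := i in
  [/\ 0 < h, k%:R * h <= t, chain_bound (@steep R) k s, measurable E & E `<=` Q /\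
    (forall z, E z -> exists2 p, p \in s & `|X z - p.1| < h /\ `|Y z - p.2| < h)].
apply: contrapT => nex.
(* The factor 4 anticipates the bound [2 d k = 4 k h] on the strip function with [d = 2 h]. *)
have /choice[I IP] : forall n : nat, exists i, good i (n.+1%:R^-1 / 4) /\
    e < Rintegral mu setT (fun x => \1_i.2 x * D Y x).
  move=> n; apply: contrapT => ni; apply: nex; exists (n.+1%:R^-1 / 4).
    by rewrite divr_gt0 // invr_gt0.
  move=> s k h E h0 kh cs mE EQ cov; rewrite leNgt; apply/negP => lt; apply: ni.
  by exists (s, k, h, E).
(* With [d = 2 h] the boxes of half-side [h] are exactly the region where [strip_fun_slope]
   applies. *)
pose F n z := strip_fun (I n).1.1.1 (I n).1.1.2 (2 * (I n).1.2) (X z) (Y z).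
have Fb n z : 0 <= F n z <= n.+1%:R^-1.
  have [] := IP n; rewrite /F; case: (I n) => [[[s k] h] E] /= [h0 kh _ _ _] _.
  have /andP[-> /=] := @strip_fun_bounds R s k (2 * h) (X z) (Y z) ltac:(lra).
  move=> /le_trans; apply; rewrite (_ : _ * k%:R = 4 * (k%:R * h)); last by ring.
  by rewrite mulrC -ler_pdivlMr.
have Flip n : lip_le 2 (F n).
  split=> [z|z z'].
    have /andP[F0 F1] := Fb n z; rewrite ger0_norm // (le_trans F1) //.
    by rewrite (@le_trans _ _ 1) ?invf_le1 ?ler1n ?ler_nat.
  apply: le_trans (strip_fun_lip _ _ _ _ _ _ _) _.
  rewrite mulr_natl mulr2n; apply: lerD; [exact: nX|exact: nY].
have lF n : Lipb (F n) by exists 2.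
have [DL _ _ wk] := dD.
have l0 := Lipb_cst (0 : R).
have iQ u : Linfty mu u -> mu.-integrable setT (fun x => (\1_Q x * u x)%:E).
  exact: integrable_indic_Linfty.
have i1 : mu.-integrable setT (EFin \o \1_Q).
  apply: eq_integrable (iQ _ (Linfty_cst mu 1)) => // x _ /=; by rewrite mulr1.
have cv x : net_cvg (fun n m : nat => (n <= m)%N : Prop) (fun n => F n x) 0.
  move=> d d0; exists (Num.truncn d^-1) => n dn.
  have /andP[F0 F1] := Fb n x; rewrite subr0 ger0_norm //; apply: le_lt_trans F1 _.
  rewrite invf_plt ?posrE //; apply: lt_le_trans (truncnS_gt _) _.
  by rewrite ler_nat.
have [N /(_ N (leqnn N))] := wk _ _ _ _ _ directed_leq Flip l0 cv _ i1 _ e0.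
rewrite (@Rintegral_ae _ _ (fun x => \1_Q x * D (fun=> 0) x) (fun=> 0)); first last.
- by move: (deriv0 dD); apply: filterS => x ->; rewrite mulr0.
- exact: measurable_cst.
- by apply: measurable_funM; [exact: measurable_indic|case: (DL _ l0)].
rewrite [X in _ - X](_ : _ = 0); last by rewrite /Rintegral integral0.
rewrite subr0 ltr_norml => /andP[_]; apply/negP; rewrite -leNgt.
have [] := IP N; rewrite /F; have := lF N; rewrite /F.
case: (I N) => [[[s k] h] E] /= lFN [h0 kh cs mE [EQ cov]] /ltW lt.
apply: le_trans lt _; apply: Rintegral_ae_le.
- apply: integrable_indic_Linfty => //; last exact: DL.
  by apply: le_lt_trans fQ; apply: le_measure; rewrite ?inE.
- by apply: iQ; exact: DL.
(* On [E] the strip function has derivative [D Y]; elsewhere in [Q] it has 0 or [D Y], both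
   nonnegative. So its integral over [Q] exceeds [e], against the weak-* limit 0. *)
have := ae_and DY (deriv_strip_fun dD mQ fQ lX lY DX (iter_upper_nil cs) lFN).
apply: filterS => x [H1 H2]; rewrite !indicE.
have [/set_mem Ex|_] := boolP (x \in E); last first.
  rewrite mul0r; have [/set_mem Qx|_] := boolP (x \in Q); last by rewrite mul0r.
  by rewrite mul1r; have [[->|->] _] := H2 Qx; rewrite ?H1.
have Qx := EQ _ Ex; rewrite mem_set // !mul1r; have [_ H] := H2 Qx.
have [p ps [xp yp]] := cov _ Ex; rewrite (H p) //.
- by rewrite (_ : 2 * h / 2 = h) //; field.
- by rewrite (_ : 2 * h / 2 = h) //; field.
Qed.

(** * Truncated coordinates and the Wronskian *)

Definition clamp (R : realType) (M t : R) : R := Num.max (- M) (Num.min t M).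

Lemma clamp_lip (R : realType) (M s t : R) : `|clamp M s - clamp M t| <= `|s - t|.
Proof.
by apply: dist_max; [rewrite subrr normr0|apply: dist_min => //; rewrite subrr normr0].
Qed.

Lemma clamp_id (R : realType) (M : nat) (t : R) :
  t \in `[- M%:R, M%:R[ -> clamp M%:R t = t.
Proof. by rewrite in_itv /= => /andP[a b]; rewrite /clamp min_l ?max_r // ltW. Qed.

Lemma clamp_bound (R : realType) (M : nat) (t : R) : `|clamp M%:R t| <= M%:R.
Proof.
have M0 : 0 <= M%:R :> R by [].
rewrite ler_norml le_max lexx /= ge_max ge_min lexx orbT andbT.
by rewrite (le_trans _ M0) // oppr_le0.
Qed.

(** The coordinates are unbounded, hence outside [Lipb]; the truncated ones agree with them on the
    square. *)
Definition xcoord (R : realType) (M : nat) (z : plane R) : R := clamp M%:R (z.1 : R).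
Definition ycoord (R : realType) (M : nat) (z : plane R) : R := clamp M%:R (z.2 : R).

Lemma xcoord_nonexp (R : realType) (M : nat) : nonexpansive (@xcoord R M).
Proof. by move=> z z'; apply: le_trans (clamp_lip _ _ _) _; exact: le_dist_fst. Qed.

Lemma ycoord_nonexp (R : realType) (M : nat) : nonexpansive (@ycoord R M).
Proof. by move=> z z'; apply: le_trans (clamp_lip _ _ _) _; exact: le_dist_snd. Qed.

Lemma Lipb_nonexp (R : realType) (M : nat) (X : plane R -> R) :
  nonexpansive X -> (forall z, `|X z| <= M%:R) -> Lipb X.
Proof.
move=> nX bX; exists (M%:R + 1); split=> [z|z z'].
  by apply: le_trans (bX z) _; rewrite lerDl.
by apply: le_trans (nX z z') _; rewrite ler_peMl ?sqrtr_ge0 // lerDr.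
Qed.

Lemma Lipb_xcoord (R : realType) (M : nat) : Lipb (@xcoord R M).
Proof. by apply: (@Lipb_nonexp _ M); [exact: xcoord_nonexp|move=> z; exact: clamp_bound]. Qed.

Lemma Lipb_ycoord (R : realType) (M : nat) : Lipb (@ycoord R M).
Proof. by apply: (@Lipb_nonexp _ M); [exact: ycoord_nonexp|move=> z; exact: clamp_bound]. Qed.

Lemma coord_square (R : realType) (M : nat) (z : plane R) :
  square M z -> xcoord M z = z.1 /\ ycoord M z = z.2.
Proof. by case=> z1 z2; split; exact: clamp_id. Qed.

(** Reflection in the diagonal lets the flat part be treated as a steep one. *)
Lemma chain_bound_swap (R : realType) (k : nat) (P : seq (R * R)) :
  chain_bound (@flat R) k P -> chain_bound (@steep R) k [seq (p.2, p.1) | p <- P].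
Proof.
move=> cP c sc cs; rewrite -(size_map (fun p => (p.2, p.1))); apply: cP.
  by rewrite sorted_map.
move=> _ /mapP[x /cs/mapP[p pP ->] ->].
by rewrite -surjective_pairing.
Qed.

Lemma Rintegral_indic_cst_le (R : realType) (mu : {measure set (plane R) -> \bar R})
    (A : set (plane R)) (W t : R) :
  measurable A -> 0 <= W -> (mu A <= t%:E)%E ->
  Rintegral mu setT (fun x => \1_A x * W) <= t * W.
Proof.
move=> mA W0 At; have fA : (mu A < +oo)%E by exact: le_lt_trans At (ltry _).
have i1 : mu.-integrable setT (EFin \o \1_A).
  apply: eq_integrable (integrable_indic_Linfty mA fA (Linfty_cst mu 1)) => // x _ /=.
  by rewrite mulr1.
rewrite RintegralZr // ler_wpM2r // /Rintegral integral_indic // setIT.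
by rewrite -lee_fin fineK // ge0_fin_numE.
Qed.

(* With [w] the Wronskian of [d1], [d2] in the coordinates, the combination
   [w (d1 x d2 - d2 x d1)] kills [x] and maps [y] to [w^2], and symmetrically
   with [x], [y] exchanged; so neither the steep nor the flat part of a thin
   cover can carry a fixed amount of the mass of [w^2]. *)
Lemma wronskian_eq0 (R : realType) (mu : {measure set (plane R) -> \bar R})
    (d1 d2 : (plane R -> R) -> plane R -> R) (M : nat) :
  locally_finite mu -> singular_wrt_leb2 mu -> derivation mu d1 -> derivation mu d2 ->
  {ae mu, forall z, square M z ->
    d1 (xcoord M) z * d2 (ycoord M) z - d2 (xcoord M) z * d1 (ycoord M) z = 0}.
Proof.
move=> lf sing D1 D2; set X := @xcoord R M; set Y := @ycoord R M.
have mQ := @measurable_square R M; have fQ := locally_finite_square M lf.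
set Q := square M in mQ fQ *.
have lX : Lipb X by exact: Lipb_xcoord.
have lY : Lipb Y by exact: Lipb_ycoord.
have nX : nonexpansive X by exact: xcoord_nonexp.
have nY : nonexpansive Y by exact: ycoord_nonexp.
have [L1 _ _ _] := D1; have [L2 _ _ _] := D2.
pose w z := d1 X z * d2 Y z - d2 X z * d1 Y z.
have lw : Linfty mu w.
  by apply: LinftyD; [|apply: LinftyN]; apply: LinftyM; do ?[exact: L1|exact: L2].
have lw2 : Linfty mu (fun z => w z ^+ 2) by exact: LinftyM.
pose Dy f z := - (w z * d2 X z) * d1 f z + (w z * d1 X z) * d2 f z.
pose Dx f z := (w z * d2 Y z) * d1 f z + (- (w z * d1 Y z)) * d2 f z.
have DDy : derivation mu Dy.
  apply: derivation_comb => //; first apply: LinftyN; apply: LinftyM => //;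
    by [exact: L1|exact: L2].
have DDx : derivation mu Dx.
  apply: derivation_comb => //; last apply: LinftyN; apply: LinftyM => //;
    by [exact: L1|exact: L2].
have DyX z : Dy X z = 0 by rewrite /Dy; ring.
have DyY z : Dy Y z = w z ^+ 2 by rewrite /Dy /w; ring.
have DxY z : Dx Y z = 0 by rewrite /Dx; ring.
have DxX z : Dx X z = w z ^+ 2 by rewrite /Dx /w; ring.
have iA A u : measurable A -> A `<=` Q -> Linfty mu u ->
    mu.-integrable setT (fun x => (\1_A x * u x)%:E).
  move=> mA AQ lu; apply: integrable_indic_Linfty => //.
  by apply: le_lt_trans fQ; apply: le_measure; rewrite ?inE.
pose J := Rintegral mu setT (fun z => \1_Q z * w z ^+ 2).
suff J0 : J <= 0.
  have J0' : J = 0.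
    apply/le_anti; rewrite J0 /=; apply: Rintegral_ge0 => z _.
    by rewrite mulr_ge0 // sqr_ge0.
  have := Rintegral_eq0 (iA _ _ mQ (fun=> id) lw2) _ J0'.
  have p0 z : 0 <= \1_Q z * w z ^+ 2 by rewrite mulr_ge0 // sqr_ge0.
  move=> /(_ p0); apply: filterS => z; rewrite indicE => h /mem_set Qz.
  by move: h; rewrite Qz mul1r => /eqP; rewrite sqrf_eq0 => /eqP.
apply/ler_addgt0Pr => e e0; rewrite add0r.
have e3 : 0 < e / 3 by lra.
have [_ [W wW]] := lw2.
(* The maximum with 1 makes the bound positive, so that dividing by it is harmless. *)
pose W' := Num.max W 1.
have W1 : 1 <= W' by rewrite le_max lexx orbT.
have W0 : 0 < W' by exact: lt_le_trans W1.
have Dy0 : {ae mu, forall z, Q z -> 0 <= Dy Y z}.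
  by apply: aeW => z _; rewrite DyY sqr_ge0.
have Dx0 : {ae mu, forall z, Q z -> 0 <= Dx X z}.
  by apply: aeW => z _; rewrite DxX sqr_ge0.
have DyX0 : {ae mu, forall z, Q z -> Dy X z = 0} by apply: aeW => z _; exact: DyX.
have DxY0 : {ae mu, forall z, Q z -> Dx Y z = 0} by apply: aeW => z _; exact: DxY.
have [t1 t10 H1] := thin_boxes_mass DDy mQ fQ lX lY nX nY DyX0 Dy0 e3.
have [t2 t20 H2] := thin_boxes_mass DDx mQ fQ lY lX nY nX DxY0 Dx0 e3.
(* The three terms make each of the steep part, the flat part and the uncovered rest contribute at
   most [e / 3]. *)
have t0 : 0 < Num.min (Num.min t1 t2) (e / 3 / W') by rewrite !lt_min t10 t20 divr_gt0.
have [h [k [P1 [P2 [h0 kh c1 c2 cov]]]]] := thin_cover M lf sing t0.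
have kh1 : k%:R * h <= t1 by apply: le_trans kh _; rewrite !ge_min lexx.
have kh2 : k%:R * h <= t2 by apply: le_trans kh _; rewrite !ge_min lexx orbT.
have {}H1 := H1 P1 k h (Q `&` boxes P1 h) h0 kh1 c1
  (measurableI _ _ mQ (measurable_boxes P1 h)) (@subIsetl _ _ _).
have {}H2 := H2 _ k h (Q `&` boxes P2 h) h0 kh2 (chain_bound_swap c2)
  (measurableI _ _ mQ (measurable_boxes P2 h)) (@subIsetl _ _ _).
have {}H1 : Rintegral mu setT (fun z => \1_(Q `&` boxes P1 h) z * w z ^+ 2) <= e / 3.
  rewrite (_ : (fun z => _) = (fun z => \1_(Q `&` boxes P1 h) z * Dy Y z)); last first.
    by apply/funext => z; rewrite DyY.
  apply: H1 => z [Qz [p pP [zp1 zp2]]]; exists p => //.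
  by rewrite /X /Y; have [-> ->] := coord_square Qz.
have {}H2 : Rintegral mu setT (fun z => \1_(Q `&` boxes P2 h) z * w z ^+ 2) <= e / 3.
  rewrite (_ : (fun z => _) = (fun z => \1_(Q `&` boxes P2 h) z * Dx X z)); last first.
    by apply/funext => z; rewrite DxX.
  apply: H2 => z [Qz [p pP [zp1 zp2]]]; exists (p.2, p.1).
    by apply/mapP; exists p.
  by rewrite /X /Y; have [-> ->] := coord_square Qz.
set E1 := Q `&` boxes P1 h in H1; set E2 := Q `&` boxes P2 h in H2.
have mE1 : measurable E1 by apply: measurableI => //; exact: measurable_boxes.
have mE2 : measurable E2 by apply: measurableI => //; exact: measurable_boxes.
pose E3 := Q `\` (boxes P1 h `|` boxes P2 h).
have mE3 : measurable E3.
  by apply: measurableD => //; apply: measurableU; exact: measurable_boxes.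
have H3 : Rintegral mu setT (fun z => \1_E3 z * W') <= e / 3.
  apply: le_trans (Rintegral_indic_cst_le mE3 (ltW W0) cov) _.
  by rewrite -ler_pdivlMr // ge_min lexx orbT.
have i1 := iA _ _ mE1 (@subIsetl _ _ _) lw2.
have i2 := iA _ _ mE2 (@subIsetl _ _ _) lw2.
have i3 := iA _ _ mE3 (@subDsetl _ _ _) (Linfty_cst mu W').
have i12 : mu.-integrable setT (EFin \o (fun z => \1_E1 z * w z ^+ 2 + \1_E2 z * w z ^+ 2)).
  exact: integrableD i1 i2.
have i123 : mu.-integrable setT (EFin \o (fun z => \1_E1 z * w z ^+ 2 +
    \1_E2 z * w z ^+ 2 + \1_E3 z * W')).
  exact: integrableD i12 i3.
(* [E1], [E2] and [E3] cover the square; overlaps only enlarge the right-hand side. *)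
apply: (@le_trans _ _ (Rintegral mu setT (fun z => \1_E1 z * w z ^+ 2 +
    \1_E2 z * w z ^+ 2 + \1_E3 z * W'))); last first.
  by rewrite RintegralD // RintegralD //; lra.
apply: Rintegral_ae_le => //; first exact: iA.
move: wW; apply: filterS => z wz.
have p1 : 0 <= \1_E1 z * w z ^+ 2 by rewrite mulr_ge0 ?sqr_ge0.
have p2 : 0 <= \1_E2 z * w z ^+ 2 by rewrite mulr_ge0 ?sqr_ge0.
have p3 : 0 <= \1_E3 z * W' by rewrite mulr_ge0 // ltW.
have [Qz|nQz] := pselect (Q z); last first.
  by rewrite indicE memNset // mul0r !addr_ge0.
rewrite [X in X * _ <= _]indicE mem_set // mul1r.
have [b1|n1] := pselect (boxes P1 h z).
  have E1z : E1 z by split.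
  by move: p2 p3; rewrite [\1_E1 z]indicE mem_set // mul1r; lra.
have [b2|n2] := pselect (boxes P2 h z).
  have E2z : E2 z by split.
  by move: p1 p3; rewrite [\1_E2 z]indicE mem_set // mul1r; lra.
have E3z : E3 z by split => // -[].
move: p1 p2; rewrite [\1_E3 z]indicE mem_set // mul1r.
have : w z ^+ 2 <= W'.
  by apply: le_trans (ler_norm _) _; apply: le_trans wz _; rewrite le_max lexx.
lra.
Qed.

(** * From vanishing Wronskians to the rank bound *)

Lemma square_exhausts (R : realType) (z : plane R) : exists M, square M z.
Proof.
pose b := Num.max `|z.1 : R| `|z.2 : R|.
have bM : b < (Num.truncn b).+1%:R by exact: truncnS_gt.
exists (Num.truncn b).+1; split; rewrite /= in_itv /=.
  have : `|z.1 : R| < (Num.truncn b).+1%:R by apply: le_lt_trans bM; rewrite le_max lexx.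
  by rewrite ltr_norml => /andP[/ltW -> ->].
have : `|z.2 : R| < (Num.truncn b).+1%:R by apply: le_lt_trans bM; rewrite le_max lexx orbT.
by rewrite ltr_norml => /andP[/ltW -> ->].
Qed.

Lemma lin_indep_pair (R : realType) (mu : {measure set (plane R) -> \bar R})
    (N : nat) (delta : 'I_N -> (plane R -> R) -> plane R -> R) (i j : 'I_N)
    (a b : plane R -> R) :
  lin_indep mu delta -> i != j -> Linfty mu a -> Linfty mu b ->
  (forall f, Lipb f -> {ae mu, forall x, a x * delta i f x + b x * delta j f x = 0}) ->
  {ae mu, forall x, a x = 0} /\ {ae mu, forall x, b x = 0}.
Proof.
move=> ind ij la lb ab.
pose lam l := if l == i then a else if l == j then b else fun=> 0.
have H := ind lam; have ji : (j == i) = false by rewrite eq_sym (negPf ij).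
have : forall l, {ae mu, forall x, lam l x = 0}.
  apply: H => [l|f lf].
    by rewrite /lam; case: ifP => // _; case: ifP => // _; exact: Linfty_cst.
  have := ab f lf; apply: filterS => x.
  rewrite (bigD1 i) //= (bigD1 j) 1?eq_sym //= /lam eqxx ji eqxx big1 ?addr0 //.
  by move=> l /andP[/negPf -> /negPf ->]; rewrite mul0r.
move=> L; split; first by have := L i; rewrite /lam eqxx.
by have := L j; rewrite /lam ji eqxx.
Qed.

(** On the square, the combination with coefficients [delta j Z] and [- delta i Z] kills both
    coordinates and hence every function; independence forces its coefficients to vanish. The
    indicator confines it to where the truncated coordinates are genuine. *)
Lemma indep_coord_eq0 (R : realType) (mu : {measure set (plane R) -> \bar R})
    (N : nat) (delta : 'I_N -> (plane R -> R) -> plane R -> R) (i j : 'I_N)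
    (M : nat) (Z : plane R -> R) :
  locally_finite mu -> lin_indep mu delta -> i != j ->
  derivation mu (delta i) -> derivation mu (delta j) -> Lipb Z ->
  {ae mu, forall x, square M x ->
     delta j Z x * delta i (xcoord M) x - delta i Z x * delta j (xcoord M) x = 0} ->
  {ae mu, forall x, square M x ->
     delta j Z x * delta i (ycoord M) x - delta i Z x * delta j (ycoord M) x = 0} ->
  {ae mu, forall x, square M x -> delta i Z x = 0} /\
  {ae mu, forall x, square M x -> delta j Z x = 0}.
Proof.
move=> lf ind ij Di Dj lZ WX WY.
have mQ := @measurable_square R M; have fQ := locally_finite_square M lf.
have [Li _ _ _] := Di; have [Lj _ _ _] := Dj.
pose a x := \1_(@square R M) x * delta j Z x.
pose b x := - (\1_(@square R M) x * delta i Z x).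
have la : Linfty mu a by apply: LinftyM; [exact: Linfty_indic|exact: Lj].
have lb : Linfty mu b by apply: LinftyN; apply: LinftyM; [exact: Linfty_indic|exact: Li].
have DD := derivation_comb Di Dj la lb.
have [|ha hb] := lin_indep_pair ind ij la lb.
  move=> f lf'.
  have : {ae mu, forall x, square M x -> a x * delta i f x + b x * delta j f x = 0}.
    apply: (deriv_eq0_of_coord DD mQ fQ (Lipb_xcoord R M) (Lipb_ycoord R M)
      (@xcoord_nonexp R M) (@ycoord_nonexp R M)) => //.
    - exact: coord_square.
    - move: WX; apply: filterS => x H Qx.
      by rewrite /a /b indicE mem_set // !mul1r mulNr; exact: H.
    - move: WY; apply: filterS => x H Qx.
      by rewrite /a /b indicE mem_set // !mul1r mulNr; exact: H.
  apply: filterS => x H; have [/H //|nQ] := pselect (square M x).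
  by rewrite /a /b indicE memNset // !mul0r oppr0 mul0r addr0.
split.
  move: hb; apply: filterS => x + Qx; rewrite /b indicE mem_set // mul1r.
  by move/eqP; rewrite oppr_eq0 => /eqP.
by move: ha; apply: filterS => x + Qx; rewrite /a indicE mem_set // mul1r.
Qed.

Theorem theorem4p1 (R : realType)
  (mu : {measure set (plane R) -> \bar R}) :
  locally_finite mu -> singular_wrt_leb2 mu -> rank_le mu 1.
Proof.
move=> lf sing N delta dd dist ind; rewrite leqNgt; apply/negP => N1.
pose i : 'I_N := Ordinal (ltn_trans (ltn0Sn 0) N1); pose j : 'I_N := Ordinal N1.
have ij : i != j by [].
(* Taking [Z] to be either coordinate, one hypothesis of [indep_coord_eq0] is commutativity and the
   other is the vanishing Wronskian. Both derivations then kill the coordinates, hence every [f]. *)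
have vanish (M : nat) (f : plane R -> R) : Lipb f ->
    {ae mu, forall x, square M x -> delta i f x = 0 /\ delta j f x = 0}.
  move=> lpf; have mQ := @measurable_square R M; have fQ := locally_finite_square M lf.
  have lX := Lipb_xcoord R M; have lY := Lipb_ycoord R M.
  have W := wronskian_eq0 M lf sing (dd i) (dd j).
  have [iX jX] : {ae mu, forall x, square M x -> delta i (xcoord M) x = 0} /\
                 {ae mu, forall x, square M x -> delta j (xcoord M) x = 0}.
    apply: indep_coord_eq0 => //.
      by apply: aeW => x _; rewrite mulrC subrr.
    by move: W; apply: filterS => x H Qx; have := H Qx; lra.
  have [iY jY] : {ae mu, forall x, square M x -> delta i (ycoord M) x = 0} /\
                 {ae mu, forall x, square M x -> delta j (ycoord M) x = 0}.
    apply: indep_coord_eq0 => //.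
      by move: W; apply: filterS => x H Qx; have := H Qx; lra.
    by apply: aeW => x _; rewrite mulrC subrr.
  have Z l : {ae mu, forall x, square M x -> delta l (xcoord M) x = 0} ->
      {ae mu, forall x, square M x -> delta l (ycoord M) x = 0} ->
      {ae mu, forall x, square M x -> delta l f x = 0}.
    move=> DX DY; apply: (deriv_eq0_of_coord (dd l) mQ fQ lX lY) => //.
    - exact: xcoord_nonexp.
    - exact: ycoord_nonexp.
    - exact: coord_square.
  have := ae_and (Z i iX iY) (Z j jX jY).
  by apply: filterS => x [H1 H2] Qx; split; [exact: H1|exact: H2].
(* Squares exhaust the plane, so both derivations are zero almost everywhere and coincide, against
   their being distinct. *)
apply: (dist i j ij) => f lpf.
have := ae_foralln (fun M => vanish M f lpf).
by apply: filterS => x H; have [M /H[-> ->]] := square_exhausts x.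
Qed.
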